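(* Let $(R,\mathfrak m)$ be an equidimensional local Noetherian ring of characteristic $p>0$ which is a homomorphic image of a Cohen--Macaulay ring, let $d=\dim R$, and let $I$ be a parameter ideal of $R$. Then for every $q=p^e$ with $e\ge 0$, $$\mathrm{e}(I)\ \ge\ \frac{\lambda\big(R/(I^{[q]})^{\ast}\big)}{q^d}\ \ge\ \lambda(R/I^{\ast}).$$
   Context: Here $p$ is a prime and $\lambda(M)$ denotes the length of an $R$-module $M$. A parameter ideal is an ideal generated by a full system of parameters of $R$. $R$ is equidimensional if $\dim R/P=\dim R$ for every minimal prime $P$ of $R$. Let $R^{\circ}$ be the complement in $R$ of the union of the minimal primes of $R$. For an ideal $I$ and $q=p^e$, $I^{[q]}=(i^q: i\in I)$. The tight closure $I^{\ast}$ of $I$ is the ideal of all $x\in R$ for which there exists $c\in R^{\circ}$ with $cx^q\in I^{[q]}$ for all sufficiently large $q=p^e$. For an $\mathfrak m$-primary ideal $I$, the Hilbert--Samuel multiplicity is $\mathrm{e}(I)=\lim_{n\to\infty} d!\,\lambda(R/I^n)/n^d$. *)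

(* Defs.v *)
From HB Require Import structures.
From mathcomp Require Import all_boot all_order all_algebra.
From mathcomp Require Import generic_quotient ring_quotient.
From mathcomp Require Import all_classical all_reals all_analysis.

Set Implicit Arguments.
Unset Strict Implicit.
Unset Printing Implicit Defensive.

Import Order.TTheory GRing.Theory Num.Theory.

Local Open Scope classical_set_scope.
Local Open Scope ring_scope.

(* A bundled [submod_closed] predicate: the library's [submodClosed] structure
   is not a [zmodClosed] one, which quotients need. *)
Record submodule (R : pzRingType) (M : lmodType R) := MkSubmodule {
  submodule_pred :> {pred M};
  submodule_closed : submod_closed submodule_pred }.

HB.instance Definition _ (R : pzRingType) (M : lmodType R) (N : submodule M) :=
  GRing.isSubmodClosed.Build R M (submodule_pred N) (submodule_closed N).

(* Ideals, possibly improper; [idealr R] and [prime_idealr R] of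
   [ring_quotient] are always proper. *)
Notation ideal R := (submodule R^o).

Section Span.
Variables (R : pzRingType) (M : lmodType R).

Definition span_pred (A : set M) : {pred M} :=
  fun x => `[< forall N : submodule M, A `<=` [set` N] -> x \in N >].

Lemma span_closed (A : set M) : submod_closed (span_pred A).
Proof.
split=> [|a x y /asboolP xA /asboolP yA]; apply/asboolP => N AN.
  exact: rpred0.
by rewrite rpredD ?rpredZ ?xA ?yA.
Qed.

Definition span (A : set M) : submodule M := MkSubmodule (span_closed A).

End Span.

Section QuotientModule.
Variables (R : pzRingType) (M : lmodType R) (N : submodule M).
Local Notation Q := (@Quotient.quot M (submodule_pred N)).
Local Open Scope quotient_scope.

Definition qscale (a : R) (x : Q) : Q := \pi_Q (a *: repr x).

Lemma pi_scale a (x : M) : \pi_Q (a *: x) = qscale a (\pi_Q x).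
Proof.
rewrite /qscale; apply/eqP; rewrite -Quotient.idealrBE -scalerBr rpredZ //.
by rewrite Quotient.idealrBE reprK.
Qed.

Lemma qscaleA a b x : qscale a (qscale b x) = qscale (a * b) x.
Proof. by rewrite -[x]reprK -!pi_scale scalerA reprK. Qed.

Lemma qscale1 : left_id 1 qscale.
Proof. by move=> x; rewrite -[x]reprK -pi_scale scale1r. Qed.

Lemma qscaleDr : right_distributive qscale +%R.
Proof.
move=> a x y; rewrite -[x]reprK -[y]reprK -[_ + _](raddfD \pi_Q) -!pi_scale.
by rewrite scalerDr raddfD.
Qed.

Lemma qscaleDl x : {morph qscale^~ x : a b / a + b}.
Proof. by move=> a b; rewrite -[x]reprK -!pi_scale scalerDl raddfD. Qed.

HB.instance Definition _ :=
  GRing.Zmodule_isLmodule.Build R Q qscaleA qscale1 qscaleDr qscaleDl.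

End QuotientModule.

(* The quotient of [R] by an ideal [J], as an [R]-module. *)
Notation quot_module J := (@Quotient.quot _ (submodule_pred J) : lmodType _).

Definition is_max (A : set nat) (n : nat) : Prop :=
  A n /\ forall k, A k -> (k <= n)%N.

Section Length.
Variables (K : realType) (R : pzRingType) (M : lmodType R).

Definition submodule_chain (n : nat) : Prop :=
  exists N : nat -> submodule M, forall i, (i < n)%N ->
    {subset N i <= N i.+1} /\ ~ {subset N i.+1 <= N i}.

(* Valued in the extended reals, +oo being the length of a module with
   arbitrarily long chains of submodules. *)
Definition length : \bar K :=
  ereal_sup [set (n%:R)%:E | n in [set n | submodule_chain n]].

End Length.

Section Ring.
Variable R : comNzRingType.

Definition ideal_gen (s : seq R) : ideal R := @span R R^o [set` s].

Definition noetherian : Prop :=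
  forall I : ideal R, exists s : seq R, I =i ideal_gen s.

Definition maximal_ideal (m : idealr R) : Prop :=
  forall J : idealr R, {subset m <= J} -> J =i m.

Definition local_ring (m : idealr R) : Prop :=
  maximal_ideal m /\ forall m', maximal_ideal m' -> m' =i m.

Definition minimal_prime (P : prime_idealr R) : Prop :=
  forall Q : prime_idealr R, {subset Q <= P} -> Q =i P.

Definition prime_chain (n : nat) : Prop :=
  exists P : nat -> prime_idealr R, forall i, (i < n)%N ->
    {subset P i <= P i.+1} /\ ~ {subset P i.+1 <= P i}.

(* [krull_dim d] says that the dimension of [R] is the natural number [d];
   it holds for no [d] when the dimension is infinite. *)
Definition krull_dim (d : nat) : Prop := is_max [set n | prime_chain n] d.

Definition regular_seq (s : seq R) : Prop :=
  1 \notin ideal_gen s /\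
  forall i, (i < size s)%N -> forall a,
    s`_i * a \in ideal_gen (take i s) -> a \in ideal_gen (take i s).

Definition depth (m : idealr R) (d : nat) : Prop :=
  is_max [set n | exists s : seq R,
    [/\ size s = n, {subset s <= m} & regular_seq s]] d.

Definition cohen_macaulay_local (m : idealr R) : Prop :=
  [/\ noetherian, local_ring m & exists2 d, krull_dim d & depth m d].

Definition radical (I : ideal R) : {pred R} :=
  fun x => `[< exists n, x ^+ n \in I >].

Definition primary (I : ideal R) : Prop :=
  1 \notin I /\ forall x y, x * y \in I -> x \in I \/ y \in radical I.

Definition m_primary (m : idealr R) (I : ideal R) : Prop :=
  primary I /\ radical I =i m.

(* [d] is meant to be the dimension of [R], so that the [x] below are the full
   systems of parameters. *)
Definition parameter_ideal (m : idealr R) (d : nat) (I : ideal R) : Prop :=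
  exists x : d.-tuple R,
    [/\ {subset x <= m}, m_primary m (ideal_gen x) & I =i ideal_gen x].

Definition ideal_pow (I : ideal R) (n : nat) : ideal R :=
  @span R R^o [set \prod_(i < n) f i | f in
                [set f : 'I_n -> R | forall i, f i \in I]].

Definition frobenius_pow (I : ideal R) (q : nat) : ideal R :=
  @span R R^o [set x ^+ q | x in [set x : R | x \in I]].

Definition Rcirc : set R :=
  [set c | forall P : prime_idealr R, minimal_prime P -> c \notin P].

Lemma Rcirc1 : Rcirc 1.
Proof. by move=> P _; rewrite idealr1. Qed.

Lemma RcircM a b : Rcirc a -> Rcirc b -> Rcirc (a * b).
Proof.
by move=> ha hb P Pmin; rewrite prime_idealrM negb_or ha ?hb.
Qed.

Definition tight_closure_pred (p : nat) (I : ideal R) : {pred R^o} :=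
  fun x : R => `[< exists2 c, Rcirc c & exists e0, forall e, (e0 <= e)%N ->
    c * x ^+ (p ^ e) \in frobenius_pow I (p ^ e) >].

Lemma tight_closure_closed (p : nat) (I : ideal R) :
  p \in [pchar R] -> submod_closed (tight_closure_pred p I).
Proof.
move=> hp; have p0 := prime_gt0 (pcharf_prime hp).
have idM (J : ideal R) (a x : R) : x \in J -> a * x \in J.
  by move=> xJ; apply: (@rpredZ R R^o J a x).
have idD (J : ideal R) (x y : R) : x \in J -> y \in J -> x + y \in J.
  exact: (@rpredD R^o J x y).
split=> [|a x y /asboolP[c cR [e1 xI]] /asboolP[c' c'R [e2 yI]]]; apply/asboolP.
  exists 1; first exact: Rcirc1.
  exists 0%N => e _; rewrite expr0n expn_eq0 eqn0Ngt p0 mulr0.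
  exact: (@rpred0 R^o).
exists (c * c'); first exact: RcircM.
exists (maxn e1 e2) => e; rewrite geq_max => /andP[/xI xe /yI ye].
have -> : (a *: x + y : R) ^+ (p ^ e) =
          a ^+ (p ^ e) * (x : R) ^+ (p ^ e) + (y : R) ^+ (p ^ e).
  by rewrite -exprMn exprDn_pchar // pnatX pnatE ?hp ?(pcharf_prime hp).
rewrite mulrDr; apply: idD; last by rewrite -mulrA; apply: idM.
by rewrite [c * c']mulrC mulrACA; apply: idM.
Qed.

Definition tight_closure (p : nat) (hp : p \in [pchar R]) (I : ideal R) :
    ideal R :=
  MkSubmodule (tight_closure_closed I hp).

End Ring.

Definition quot_length (K : realType) (R : comNzRingType) (J : ideal R) :
  \bar K := length K (quot_module J).

(* [d] is meant to be the dimension of [R]. *)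
Definition multiplicity (K : realType) (R : comNzRingType) (d : nat)
    (I : ideal R) : \bar K :=
  limn (fun n => ((d`!)%:R)%:E * quot_length K (ideal_pow I n)
                   * (((n ^ d)%:R)^-1)%:E)%E.

(* An equality of dimensions in {0, 1, ..., oo}. *)
Definition equidimensional (R : comNzRingType) : Prop :=
  forall P : prime_idealr R, minimal_prime P ->
  forall d, krull_dim {ideal_quot P} d <-> krull_dim R d.

(* The localization at [m], characterized up to unique isomorphism. *)
Definition is_localization (S L : comNzRingType) (m : idealr S)
    (f : {rmorphism S -> L}) : Prop :=
  [/\ forall s, s \notin m -> exists y, f s * y = 1,
      forall z, exists a s, s \notin m /\ z * f s = f a
    & forall a, f a = 0 <-> exists2 s, s \notin m & s * a = 0].

Definition cohen_macaulay (S : comNzRingType) : Prop :=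
  noetherian S /\
  forall m : idealr S, maximal_ideal m ->
  exists (L : comNzRingType) (f : {rmorphism S -> L}) (n : idealr L),
    is_localization m f /\ cohen_macaulay_local n.

Definition image_of_cohen_macaulay (R : comNzRingType) : Prop :=
  exists (S : comNzRingType) (f : {rmorphism S -> R}),
    cohen_macaulay S /\ forall y, exists x, f x = y.

(* Main.v *)
Require Import Defs.
From HB Require Import structures.
From mathcomp Require Import all_boot all_order all_algebra.
From mathcomp Require Import generic_quotient ring_quotient.
From mathcomp Require Import ring zify.
From mathcomp Require Import all_classical all_reals all_analysis.

(** Write [q = p ^ e], [I = (x_1, ..., x_d)], [I^[q] = (x_1^q, ..., x_d^q)], and [J^*]
    for the tight closure of [J].

    Everything rests on uniform colon capturing ([parameter_colon]): there is one
    [c] off the minimal primes of [R] such that, for all exponents,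
    [c ((x_1^a_1, ..., x_k^a_k) : x_(k+1)^a_(k+1))] lies in
    [(x_1^a_1, ..., x_k^a_k)]; this holds for each order of the parameters.

    Second inequality. Taking Frobenius powers, colon capturing gives
    [(y, z^(n+1))^* : z^n] inside [(y, z)^*]. Multiplication by [z^n] therefore
    yields [length R/(y, z^(n+1))^* >= length R/(y, z)^* + length R/(y, z^n)^*],
    hence [length R/(y, z^q)^* >= q length R/(y, z)^*]; raising the parameters to
    the power [q] one after the other gives the factor [q^d]
    ([chain_tc_power], [chain_tc_powers]).

    First inequality. The same argument applied to the ideals [(t) + (z, s)^n],
    with Pascal's rule in place of the count of powers, gives
    [length R/((I^[q])^(n+1))^* >= 'C(n + d, d) length R/(I^[q])^*]
    ([mixed_capture], [chain_tc_mixed]). As [I^(q (n+1+d))] lies in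
    [(I^[q])^(n+1)] ([pw_frob_sub]), dividing by [(q (n+1+d))^d / d!] and letting
    [n] grow gives the claim ([hseq_lower]). The limit that defines the
    multiplicity exists because [length (R/I^(n+1)) / 'C(n + d, d)] does not
    increase with [n]; this follows from the bound of a Hilbert function in degree
    [n + 1] by its value in degree [n] ([hilbert_ratio], [hsf_ratio]). If [R/I] has
    infinite length, the multiplicity is infinite.

    Colon capturing. Localizing, let [R = L/J] with [L] local Cohen-Macaulay of
    dimension [D]. A maximal [L]-regular sequence [y] inside [J] has length
    [D - d], the minimal primes of [J] are minimal over [(y)], and the parameters
    lift to a sequence that is regular modulo [(y)] ([regular_lift],
    [parameter_killer]). The dimension theory needed here is replaced by a direct
    study of depth: cutting by a regular element lowers the depth by at
    most one ([depthge_cut]), and the depth of [L/b] is at most the number of generators of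
    the maximal ideal modulo an associated prime of [b] and up to radical
    ([depthge_ass]). The element [c] comes from [uniform_killer]: modulo any ideal
    over [(y)], a single element off given minimal primes of [(y)] makes all
    [(y)]-regular sequences of a given length regular up to [c]. *)

Set Implicit Arguments.
Unset Strict Implicit.
Unset Printing Implicit Defensive.

Import Order.TTheory GRing.Theory Num.Theory.
Local Open Scope classical_set_scope.
Local Open Scope ring_scope.

(** * Ideals *)

Section Ideals.
Variable R : comNzRingType.
Implicit Types (I J B : ideal R) (u v r x z : R) (s t : seq R).

Lemma idl0 I : 0 \in I.
Proof. exact: (@rpred0 R^o). Qed.

Lemma idlD I u v : u \in I -> v \in I -> u + v \in I.
Proof. exact: (@rpredD R^o). Qed.

Lemma idlN I u : u \in I -> - u \in I.
Proof. by move=> uI; apply: (@rpredNr R^o _ u uI). Qed.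

Lemma idlB I u v : u \in I -> v \in I -> u - v \in I.
Proof. by move=> uI vI; apply: idlD => //; apply: idlN. Qed.

Lemma idlMl I r u : u \in I -> r * u \in I.
Proof. exact: (@rpredZ R R^o I r u). Qed.

Lemma idlMr I r u : u \in I -> u * r \in I.
Proof. by rewrite mulrC; apply: idlMl. Qed.

Lemma idl_sub I u v : u - v \in I -> v \in I -> u \in I.
Proof. by move=> h1 h2; rewrite -(subrK v u); apply: idlD. Qed.

Lemma idl_subr I u v : u - v \in I -> u \in I -> v \in I.
Proof. by move=> h1 h2; rewrite -[v](subKr u); apply: idlB. Qed.

Lemma ideal_eq I J : {subset I <= J} -> {subset J <= I} -> I = J.
Proof.
case: I J => [P hP] [Q hQ] IJ JI.
have E : P = Q.
  apply/funext => u; apply/idP/idP; first exact: (IJ u).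
  exact: (JI u).
by clear IJ JI; move: hQ; rewrite -E => hQ; congr MkSubmodule; apply: Prop_irrelevance.
Qed.

Lemma ideal_eqi I J : I =i J -> I = J.
Proof. by move=> E; apply: ideal_eq => u; rewrite E. Qed.

Section Make.
Variable P : R -> Prop.
Hypotheses (P0 : P 0) (PS : forall r u v, P u -> P v -> P (r * u + v)).

Lemma mk_ideal_closed : submod_closed ((fun u => `[< P u >]) : {pred R^o}).
Proof.
by split=> [|r u v /asboolP Pu /asboolP Pv]; apply/asboolP; [|apply: PS].
Qed.

(** Sealed by [Qed], so that simplification does not unfold memberships. *)
Lemma mk_ideal_sig : {J : ideal R | forall u, u \in J <-> P u}.
Proof. by exists (MkSubmodule mk_ideal_closed) => u; split=> /asboolP. Qed.

Definition mk_ideal : ideal R := sval mk_ideal_sig.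

Lemma mk_idealP u : u \in mk_ideal <-> P u.
Proof. exact: (svalP mk_ideal_sig). Qed.
End Make.

Definition idl_top : ideal R := @mk_ideal (fun _ => True) I (fun _ _ _ _ _ => I).

Lemma in_top u : u \in idl_top.
Proof. exact/mk_idealP. Qed.

Lemma idl_topP I : 1 \in I -> I = idl_top.
Proof.
move=> I1; apply: ideal_eq => u _; first exact: in_top.
by rewrite -[u]mulr1; apply: idlMl.
Qed.

Lemma idl_zeroS r u v : u = 0 -> v = 0 -> r * u + v = 0.
Proof. by move=> -> ->; rewrite mulr0 addr0. Qed.

Definition idl_zero : ideal R := mk_ideal (erefl 0) idl_zeroS.

Lemma in_zero u : u \in idl_zero <-> u = 0.
Proof. exact: mk_idealP. Qed.

Section Constructions.
Variables (I B : ideal R) (z : R).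

Lemma zadd0 : exists2 b, b \in B & 0 - z * b \in I.
Proof. by exists 0; rewrite ?mulr0 ?subrr; apply: idl0. Qed.

Lemma zaddS r u v : (exists2 b, b \in B & u - z * b \in I) ->
  (exists2 b, b \in B & v - z * b \in I) ->
  exists2 b, b \in B & r * u + v - z * b \in I.
Proof.
move=> [b bB hb] [c cB hc]; exists (r * b + c).
  by apply: idlD => //; apply: idlMl.
have -> : r * u + v - z * (r * b + c) = r * (u - z * b) + (v - z * c) by ring.
by apply: idlD => //; apply: idlMl.
Qed.

(** The ideal [I + z B]. *)
Definition zadd : ideal R := mk_ideal zadd0 zaddS.

Lemma zaddP u : u \in zadd <-> exists2 b, b \in B & u - z * b \in I.
Proof. exact: mk_idealP. Qed.

Lemma colon0 : 0 * z \in I. Proof. by rewrite mul0r; apply: idl0. Qed.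
Lemma colonS r u v : u * z \in I -> v * z \in I -> (r * u + v) * z \in I.
Proof.
move=> hu hv; have -> : (r * u + v) * z = r * (u * z) + v * z by ring.
by apply: idlD => //; apply: idlMl.
Qed.

Definition colon : ideal R := mk_ideal colon0 colonS.

Lemma colonP u : u \in colon <-> u * z \in I.
Proof. exact: mk_idealP. Qed.

Lemma meetS r u v : u \in I /\ u \in B -> v \in I /\ v \in B ->
  r * u + v \in I /\ r * u + v \in B.
Proof. by move=> [? ?] [? ?]; split; apply: idlD => //; apply: idlMl. Qed.

Definition meet : ideal R := mk_ideal (conj (idl0 I) (idl0 B)) meetS.

Lemma meetP u : u \in meet <-> u \in I /\ u \in B.
Proof. exact: mk_idealP. Qed.

End Constructions.

Definition iadd I x := zadd I idl_top x.

Lemma iaddP I x u : u \in iadd I x <-> exists r, u - r * x \in I.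
Proof.
split=> [/zaddP[r _ h]|[r h]]; first by exists r; rewrite mulrC.
by apply/zaddP; exists r; [apply: in_top | rewrite mulrC].
Qed.

Lemma zadd_sub I B z : {subset I <= zadd I B z}.
Proof.
by move=> u uI; apply/zaddP; exists 0; rewrite ?mulr0 ?subr0 //; apply: idl0.
Qed.

Lemma zadd_in I B z b : b \in B -> z * b \in zadd I B z.
Proof. by move=> bB; apply/zaddP; exists b; rewrite // subrr; apply: idl0. Qed.

Lemma zadd_le I B z J :
  {subset I <= J} -> (forall b, b \in B -> z * b \in J) ->
  {subset zadd I B z <= J}.
Proof.
move=> IJ BJ u /zaddP[b bB h]; apply: (idl_sub (IJ _ h)); exact: BJ.
Qed.

Lemma iadd_sub I x : {subset I <= iadd I x}.
Proof. exact: zadd_sub. Qed.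

Lemma iadd_in I x : x \in iadd I x.
Proof. by apply/iaddP; exists 1; rewrite mul1r subrr; apply: idl0. Qed.

Lemma iadd_le I x J : {subset I <= J} -> x \in J -> {subset iadd I x <= J}.
Proof. by move=> IJ xJ; apply: zadd_le => // r _; apply: idlMr. Qed.

Lemma iaddS I J x : {subset I <= J} -> {subset iadd I x <= iadd J x}.
Proof.
move=> IJ; apply: iadd_le; last exact: iadd_in.
by move=> u /IJ; apply: iadd_sub.
Qed.

Lemma iaddAC I x z : iadd (iadd I x) z = iadd (iadd I z) x.
Proof.
suff H a b : {subset iadd (iadd I a) b <= iadd (iadd I b) a}.
  by apply: ideal_eq; apply: H.
apply: iadd_le; last by apply: iadd_sub; apply: iadd_in.
by apply: iadd_le (iadd_in _ _) => u uI; do 2!apply: iadd_sub.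
Qed.

Lemma iadd_id I x : x \in I -> iadd I x = I.
Proof. by move=> xI; apply: ideal_eq; [apply: iadd_le | apply: iadd_sub]. Qed.

(** The ideal generated by [I] and [s], built up from the head of [s]. *)
Definition adds I s := foldl iadd I s.

Lemma adds_sub I s : {subset I <= adds I s}.
Proof.
elim: s I => [|x s IH] I u uI //=; apply: IH; exact: iadd_sub.
Qed.

Lemma adds_le I s J :
  {subset I <= J} -> {subset s <= J} -> {subset adds I s <= J}.
Proof.
elim: s I => [|x s IH] I IJ sJ //=; apply: IH.
  by apply: iadd_le => //; apply: sJ; rewrite mem_head.
by move=> u us; apply: sJ; rewrite in_cons us orbT.
Qed.

Lemma adds_in I s : {subset s <= adds I s}.
Proof.
elim: s I => [|x s IH] I u //=; rewrite in_cons => /orP[/eqP->|/IH //].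
by apply: adds_sub; apply: iadd_in.
Qed.

Lemma addsS I J s : {subset I <= J} -> {subset adds I s <= adds J s}.
Proof.
move=> IJ; apply: adds_le; last exact: adds_in.
by move=> u /IJ; apply: adds_sub.
Qed.

Lemma adds_cat I s t : adds I (s ++ t) = adds (adds I s) t.
Proof. exact: foldl_cat. Qed.

Lemma adds_eqmem I s t : s =i t -> adds I s = adds I t.
Proof.
by move=> E; apply: ideal_eq; (apply: adds_le; first exact: adds_sub);
   move=> u us; apply: adds_in; rewrite ?E // -E.
Qed.

Lemma adds_iadd I x s : adds (iadd I x) s = iadd (adds I s) x.
Proof.
by elim: s I => [|y s IH] I //=; rewrite -IH iaddAC.
Qed.

Lemma spanP (A : set R) u :
  u \in @Defs.span R R^o A <-> forall J, (forall v, A v -> v \in J) -> u \in J.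
Proof. by split=> [/asboolP h J AJ|h]; [apply: h | apply/asboolP => J; apply: h]. Qed.

Lemma gen_adds s : ideal_gen s = adds idl_zero s.
Proof.
apply: ideal_eq => u.
  by move/spanP; apply=> v vs; apply: adds_in.
move=> us; apply/spanP => J sJ; apply: adds_le us => [v /in_zero->|v].
  exact: idl0.
exact: sJ.
Qed.

Lemma gen_in s : {subset s <= ideal_gen s}.
Proof. by rewrite gen_adds; apply: adds_in. Qed.

Lemma gen_le s J : {subset s <= J} -> {subset ideal_gen s <= J}.
Proof.
move=> sJ; rewrite gen_adds; apply: adds_le => // v /in_zero->; exact: idl0.
Qed.

Lemma gen_cons x s : ideal_gen (x :: s) = iadd (ideal_gen s) x.
Proof. by rewrite !gen_adds /= adds_iadd. Qed.

Lemma gen_nil : ideal_gen [::] = idl_zero :> ideal R.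
Proof. by rewrite gen_adds. Qed.

Lemma gen_cat s t : ideal_gen (s ++ t) = adds (ideal_gen s) t.
Proof. by rewrite !gen_adds adds_cat. Qed.

Lemma gen_eqmem s t : s =i t -> ideal_gen s = ideal_gen t.
Proof. by rewrite !gen_adds; apply: adds_eqmem. Qed.

(** Regularity up to the factor [c], which replaces exactness throughout: for
    [c = 1] this says that [x] is a nonzerodivisor on [R/I]. *)
Definition creg c I x := forall u, u * x \in I -> c * u \in I.

(** Regular sequences on [R/I], up to the factor [c]; the last quotient may
    vanish. *)
Fixpoint good c I s : Prop :=
  if s is x :: s' then creg c I x /\ good c (iadd I x) s' else True.

Definition reg I s := good 1 I s.

Lemma good_mulr c c' I s : good c I s -> good (c' * c) I s.
Proof.
elim: s I => [|x s IH] I //= [h1 h2]; split; last exact: IH.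
by move=> u /h1 h; rewrite -mulrA; apply: idlMl.
Qed.

Lemma good_cat c I s t : good c I (s ++ t) <-> good c I s /\ good c (adds I s) t.
Proof. by elim: s I => [|x s IH] I /=; rewrite ?IH; tauto. Qed.

Lemma good_ann c I s : c \in I -> good c I s.
Proof.
elim: s I => [|x s IH] I cI //=; split; last exact/IH/iadd_sub.
by move=> u _; apply: idlMr.
Qed.

End Ideals.
Arguments idl_zero {R}.
Arguments idl_top {R}.

(** * Associated primes and prime avoidance *)

Section Primes.
Variable R : comNzRingType.
Implicit Types (I J P Q : ideal R) (u v x y : R) (ps : seq (ideal R)).

Definition isprime P : Prop :=
  1 \notin P /\ forall u v, u * v \in P -> u \in P \/ v \in P.

Lemma isprimeX P u n : isprime P -> u ^+ n \in P -> u \in P.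
Proof.
move=> [P1 Pp]; elim: n => [|n IH]; first by rewrite expr0 (negbTE P1).
by rewrite exprS => /Pp[].
Qed.

Fixpoint in_list P ps : Prop := if ps is Q :: ps' then P = Q \/ in_list P ps' else False.

Lemma in_list_cat P ps qs : in_list P (ps ++ qs) <-> in_list P ps \/ in_list P qs.
Proof. by elim: ps => [|Q ps IH] /=; rewrite ?IH; tauto. Qed.

Lemma in_list_filter (p : pred (ideal R)) P ps :
  in_list P [seq Q <- ps | p Q] <-> in_list P ps /\ p P.
Proof.
elim: ps => [|Q ps IH] /=; first by split=> // -[].
case: ifP => pQ /=; rewrite IH.
  by split=> [[->|[? ?]]|[[->|?] ?]]; tauto.
split=> [[? ?]|[[->|? //] h]]; first by tauto.
by rewrite pQ in h.
Qed.

(** The condition under which [coset_avoid] can treat a list of primes from its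
    tail: no later ideal is contained in an earlier one. *)
Fixpoint none_below_earlier ps : Prop :=
  if ps is P :: ps' then (forall Q, in_list Q ps' -> ~ {subset Q <= P}) /\ none_below_earlier ps'
  else True.

Lemma none_below_earlier_rcons ps P :
  none_below_earlier ps -> (forall Q, in_list Q ps -> ~ {subset P <= Q}) ->
  none_below_earlier (rcons ps P).
Proof.
elim: ps => [|Q ps IH] //= [h1 h2] h3; split; last first.
  by apply: IH => // Q' hQ'; apply: h3; right.
move=> Q'; rewrite -cats1 in_list_cat /= => -[/h1 //|[->|//]].
by apply: h3; left.
Qed.

(** Dropping the ideals that lie in another one does not change what it means to
    avoid all of them. *)
Lemma none_below_earlier_reduce ps : exists ps',
  [/\ none_below_earlier ps', forall P, in_list P ps' -> in_list P ps
  & forall P, in_list P ps -> exists2 P', in_list P' ps' & {subset P <= P'}].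
Proof.
elim: ps => [|P ps [ps' [h1 h2 h3]]]; first by exists [::].
have [[P' P'in PP']|nP] := pselect (exists2 P', in_list P' ps' & {subset P <= P'}).
  exists ps'; split=> //; first by move=> Q /h2; right.
  by move=> Q /= [->|/h3 //]; exists P'.
exists (rcons ps' P); split.
- by apply: none_below_earlier_rcons => // Q Qin QP; apply: nP; exists Q.
- by move=> Q; rewrite -cats1 in_list_cat /= => -[/h2|[]]; tauto.
- move=> Q /= [->|/h3[Q' Q'in QQ']].
    by exists P => //; rewrite -cats1 in_list_cat /=; tauto.
  by exists Q' => //; rewrite -cats1 in_list_cat /=; tauto.
Qed.

Lemma notsub I J : ~ {subset I <= J} -> exists2 u, u \in I & u \notin J.
Proof.
move=> h; apply/not_exists2P => h'; apply: h => u uI.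
by case: (h' u) => // /negP; rewrite negbK.
Qed.

Lemma prime_meet_avoid J ps P : isprime P -> ~ {subset J <= P} ->
  (forall Q, in_list Q ps -> ~ {subset Q <= P}) ->
  exists y, [/\ y \in J, y \notin P & forall Q, in_list Q ps -> y \in Q].
Proof.
move=> [P1 Pp] JP; elim: ps => [|Q ps IH] h.
  by have [y yJ yP] := notsub JP; exists y; split.
have [|y [yJ yP yps]] := IH; first by move=> Q' hQ'; apply: h; right.
have [z zQ zP] := notsub (h Q (or_introl (erefl _))).
exists (y * z); split; first exact: idlMr.
  by apply/negP => /Pp[]; apply/negP.
by move=> Q' /= [->|/yps]; [apply: idlMl | apply: idlMr].
Qed.

(** Prime avoidance for a coset [x + J]: the induction works on a list in which
    no prime lies below an earlier one. *)
Lemma coset_avoid ps J x : (forall P, in_list P ps -> isprime P) ->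
  (forall P, in_list P ps -> x \in P -> {subset J <= P} -> False) ->
  exists2 j, j \in J & forall P, in_list P ps -> x + j \notin P.
Proof.
move=> hp hx.
suff H qs : none_below_earlier qs -> (forall P, in_list P qs -> isprime P) ->
    (forall P, in_list P qs -> x \in P -> {subset J <= P} -> False) ->
    exists2 j, j \in J & forall P, in_list P qs -> x + j \notin P.
  have [qs [h1 h2 h3]] := none_below_earlier_reduce ps.
  have [||j jJ hj] := H qs h1; first by move=> P /h2/hp.
    by move=> P /h2/hx.
  exists j => // P /h3[P' /hj jP' PP']; apply: contra jP'; exact: PP'.
elim: qs {ps hp hx} => [|P qs IH] /=; first by exists 0 => //; apply: idl0.
move=> [hP hqs] hp hx.
have [||j jJ hj] := IH hqs; first by move=> Q hQ; apply: hp; right.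
  by move=> Q hQ; apply: hx; right.
(* If [j] fails at [P], correct it by an element of all other primes. *)
have [xjP|xjP] := boolP (x + j \in P); last first.
  by exists j => // Q [->|/hj].
have JP : ~ {subset J <= P}.
  move=> JP; apply: (hx P) => //; first by left.
  by rewrite -[x](addrK j); apply: idlB => //; apply: JP.
have Pp : isprime P by apply: hp; left.
have [y [yJ yP yqs]] := prime_meet_avoid Pp JP hP.
exists (j + y); first exact: idlD.
move=> Q [->|Qin]; rewrite addrA; apply/negP => h.
  by move/negP: yP; apply; rewrite -[y](addKr (x + j)); apply: idlD => //; exact: idlN.
by move/negP: (hj _ Qin); apply; rewrite -[x + j](addrK y); apply: idlB => //; apply: yqs.
Qed.

Definition ass I Q : Prop := isprime Q /\ exists v, Q = colon I v.

Lemma ass_sub I Q : ass I Q -> {subset I <= Q}.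
Proof. by move=> [_ [v ->]] u uI; apply/colonP; apply: idlMr. Qed.

Lemma ass_wit I Q : ass I Q -> exists2 v, v \notin I & Q = colon I v.
Proof.
move=> [[Q1 _] [v Qv]]; exists v => //; apply: contra Q1 => vI.
by rewrite Qv; apply/colonP; rewrite mul1r.
Qed.

Hypothesis noethR : noetherian R.

(** The maximal condition: a strictly increasing sequence of ideals would have a
    union that is not finitely generated. *)
Lemma noeth_max (T : ideal R -> Prop) I : T I -> exists J,
  [/\ T J, {subset I <= J} & forall J', T J' -> {subset J <= J'} -> J' = J].
Proof.
move=> TI; apply/not_existsP => h.
have h' (X : {J | T J /\ {subset I <= J}}) :
    {Y : {J | T J /\ {subset I <= J}} |
      {subset sval X <= sval Y} /\ ~ {subset sval Y <= sval X}}.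
  apply: cid; case: X => J [TJ IJ] /=.
  apply/not_existsP => h2; apply: (h J); split=> // J' TJ' JJ'.
  apply: ideal_eq => //; apply: contrapT => J'J.
  have IJ' : {subset I <= J'} by move=> u /IJ/JJ'.
  by apply: (h2 (exist _ J' (conj TJ' IJ'))).
pose X0 : {J | T J /\ {subset I <= J}} := exist _ I (conj TI (fun u uI => uI)).
pose N n := sval (iter n (fun X => sval (h' X)) X0).
have NS n : {subset N n <= N n.+1} by case: (svalP (h' (iter n (fun X => sval (h' X)) X0))).
have Nlt n : ~ {subset N n.+1 <= N n} by case: (svalP (h' (iter n (fun X => sval (h' X)) X0))).
have Nle m n : (m <= n)%N -> {subset N m <= N n}.
  by move=> mn u um; rewrite -(subnK mn); elim: (n - m)%N => [|k /NS].
have U0 : exists n, 0 \in N n by exists 0%N; apply: idl0.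
have US r u v : (exists n, u \in N n) -> (exists n, v \in N n) ->
    exists n, r * u + v \in N n.
  move=> [n un] [k vk]; exists (maxn n k); apply: idlD.
    by apply: idlMl; apply: Nle un; apply: leq_maxl.
  by apply: Nle vk; apply: leq_maxr.
have [s Us] := noethR (mk_ideal U0 US).
have [n sn] : exists n, {subset s <= N n}.
  have : forall u, u \in s -> exists n, u \in N n.
    by move=> u us; apply/(mk_idealP U0 US); rewrite Us; apply: gen_in.
  elim: s {Us} => [|x s IH] hs; first by exists 0%N.
  have [|n hn] := IH; first by move=> u us; apply: hs; rewrite in_cons us orbT.
  have [k hk] := hs x (mem_head _ _).
  exists (maxn n k) => u; rewrite in_cons => /orP[/eqP->|/hn].
    by apply: Nle hk; apply: leq_maxr.
  by apply: Nle; apply: leq_maxl.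
apply: (Nlt n) => u un; apply: (gen_le sn).
by rewrite -Us; apply/(mk_idealP U0 US); exists n.+1.
Qed.

(** A maximal proper ideal of the form [I : v] is prime. *)
Lemma ass_exists I v : v \notin I ->
  exists2 Q, ass I Q & {subset colon I v <= Q}.
Proof.
move=> vI.
pose T J := exists2 w, w \notin I & J = colon I w.
have [J [[w wI ->] h1 h2]] := @noeth_max T (colon I v) (ex_intro2 _ _ v vI (erefl _)).
exists (colon I w) => //; split; last by exists w.
split; first by apply/negP => /colonP; rewrite mul1r; apply/negP.
move=> a b /colonP abw; have [bw|bw] := boolP (b * w \in I).
  by right; apply/colonP.
left; rewrite -(h2 (colon I (b * w))); last 2 first.
- by exists (b * w).
- move=> u /colonP uw; apply/colonP.
  by rewrite mulrCA; apply: idlMl.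
by apply/colonP; rewrite mulrA.
Qed.

Lemma creg_ass I x : (forall Q, ass I Q -> x \notin Q) -> creg 1 I x.
Proof.
move=> h u uxI; rewrite mul1r; apply: contrapT => /negP uI.
have [Q Qass uQ] := ass_exists uI.
by move/negP: (h _ Qass); apply; apply: uQ; apply/colonP; rewrite mulrC.
Qed.

(** An ideal [I : v] that is maximal among those contained in [P] is prime. *)
Lemma ass_below I P : isprime P -> {subset I <= P} ->
  exists2 Q, ass I Q & {subset Q <= P}.
Proof.
move=> [P1 Pp] IP.
(* Maximality is used for [r * w] with [r] off [P], which stays below [P]. *)
pose T J := {subset J <= P} /\ exists w, J = colon I w.
have [|J [[JP [w Jw]] _ h2]] := @noeth_max T (colon I 1).
  by split; [move=> u /colonP; rewrite mulr1 => /IP | exists 1].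
exists J => //; split; last by exists w.
split; first by apply/negP => /JP; apply/negP.
move=> a b abJ; have [bwP|bwP] := pselect ({subset colon I (b * w) <= P}).
  left; rewrite -(h2 (colon I (b * w))).
  - by apply/colonP; move: abJ; rewrite Jw => /colonP; rewrite mulrA.
  - by split=> //; exists (b * w).
  - rewrite Jw => u /colonP uw; apply/colonP.
    by rewrite mulrCA; apply: idlMl.
have [r /colonP rbw rP] := notsub bwP.
right; rewrite -(h2 (colon I (r * w))).
- by apply/colonP; rewrite mulrCA.
- split; last by exists (r * w).
  move=> u /colonP; rewrite mulrA => h.
  have /JP/Pp[//|] : u * r \in J by rewrite Jw; apply/colonP.
  by rewrite (negbTE rP).
- rewrite Jw => u /colonP uw; apply/colonP.
  by rewrite mulrCA; apply: idlMl.
Qed.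

Lemma min_ass I P : isprime P -> {subset I <= P} ->
  (forall Q, isprime Q -> {subset I <= Q} -> {subset Q <= P} -> Q = P) -> ass I P.
Proof.
move=> Pp IP Pmin; have [Q Qass QP] := ass_below Pp IP.
by rewrite -(Pmin Q) //; [case: Qass | apply: ass_sub].
Qed.

(** By Noetherian induction: if [Q = I : v] is prime, the associated primes of
    [I] other than [Q] are associated to [I + (v)]. *)
Lemma ass_finite I : exists ps, forall Q, ass I Q -> in_list Q ps.
Proof.
apply: contrapT => nI.
have [J [nJ _ Jmax]] := @noeth_max (fun I => ~ exists ps, forall Q, ass I Q -> in_list Q ps) I nI.
apply: nJ; have [[v vJ]|h] := pselect (exists v, v \notin J); last first.
  exists [::] => Q /ass_wit[w wJ _]; apply: h; by exists w.
have [Q0 Q0ass _] := ass_exists vJ.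
have [w wJ Q0w] := ass_wit Q0ass.
have [ps hps] : exists ps, forall Q, ass (iadd J w) Q -> in_list Q ps.
  apply: contrapT => /Jmax/(_ (@iadd_sub _ _ _)) E.
  by move/negP: wJ; apply; rewrite -E; apply: iadd_in.
exists (Q0 :: ps) => Q Qass; have [y yJ Qy] := ass_wit Qass.
have [Qp _] := Qass.
(* If [R y] meets [J + (w)] outside [J], both [Q] and [Q0] annihilate a common
   element modulo [J]; otherwise [Q] is still the annihilator of [y] modulo
   [J + (w)]. *)
have [[r ryw ryJ]|h] := pselect (exists2 r, r * y \in iadd J w & r * y \notin J).
  left; move/iaddP: ryw => [a ha].
  have rQ : r \notin Q by rewrite Qy; apply/negP => /colonP; apply/negP.
  have aQ0 : a \notin Q0.
    rewrite Q0w; apply/negP => /colonP awJ; move/negP: ryJ; apply.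
    by apply: idl_sub ha _.
  have Q0p : isprime Q0 by case: Q0ass.
  have E u : (u * r * y \in J) = (u * a * w \in J).
    have D : u * r * y - u * a * w \in J.
      have -> : u * r * y - u * a * w = u * (r * y - a * w) by ring.
      exact: idlMl.
    by apply/idP/idP => ?; [apply: idl_subr D _ | apply: idl_sub D _].
  apply: ideal_eq => u uQ.
    have : u * a \in Q0.
      by rewrite Q0w; apply/colonP; rewrite -E -mulrA mulrCA; apply: idlMl;
         move: uQ; rewrite Qy => /colonP.
    by case: Q0p => _ Q0p /Q0p[] //; rewrite (negbTE aQ0).
  have : u * r \in Q.
    by rewrite Qy; apply/colonP; rewrite E -mulrA mulrCA; apply: idlMl;
       move: uQ; rewrite Q0w => /colonP.
  by case: Qp => _ Qp /Qp[] //; rewrite (negbTE rQ).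
right; apply: hps; split=> //; exists y; rewrite Qy.
apply: ideal_eq => u /colonP uy; apply/colonP; first exact: iadd_sub.
by apply: contrapT => /negP uyJ; apply: h; exists u.
Qed.

Lemma exists_creg2 I1 I2 J x :
  (forall Q, ass I1 Q \/ ass I2 Q -> x \in Q -> {subset J <= Q} -> False) ->
  exists2 j, j \in J & creg 1 I1 (x + j) /\ creg 1 I2 (x + j).
Proof.
move=> h; have [ps1 h1] := ass_finite I1; have [ps2 h2] := ass_finite I2.
pose ps := [seq Q <- ps1 ++ ps2 | `[< ass I1 Q \/ ass I2 Q >]].
have hps Q : in_list Q ps <-> ass I1 Q \/ ass I2 Q.
  rewrite in_list_filter in_list_cat; split=> [[_ /asboolP]//|H]; split; last exact/asboolP.
  by case: H => [/h1|/h2]; tauto.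
have [||j jJ hj] := @coset_avoid ps J x.
- by move=> P /hps[] [].
- by move=> P /hps; apply: h.
exists j => //; split; apply: creg_ass => Q Qa; apply: hj; apply/hps; tauto.
Qed.

Lemma exists_creg I J x :
  (forall Q, ass I Q -> x \in Q -> {subset J <= Q} -> False) ->
  exists2 j, j \in J & creg 1 I (x + j).
Proof.
move=> h; have [|j jJ [hj _]] := @exists_creg2 I I J x; last by exists j.
by move=> Q [] /h.
Qed.

Lemma exists_creg0 I1 I2 J :
  (forall Q, ass I1 Q \/ ass I2 Q -> {subset J <= Q} -> False) ->
  exists2 j, j \in J & creg 1 I1 j /\ creg 1 I2 j.
Proof.
move=> h; have [Q /h h' _|j jJ] := @exists_creg2 I1 I2 J 0; first exact: h'.
by rewrite add0r; exists j.
Qed.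

End Primes.

(** * Regular sequences and depth in a local ring *)

Section Depth.
Variable R : comNzRingType.
Implicit Types (I J P Q b : ideal R) (u v w x y z t : R) (s xs : seq R).

Lemma creg1P I x : creg 1 I x <-> forall u, u * x \in I -> u \in I.
Proof. by split=> h u /h; rewrite mul1r. Qed.

(** From [u x = v z] modulo [I], the regularity of [z] modulo [x] makes [v] a
    multiple of [x], which cancels. *)
Lemma creg_swap I x z : creg 1 I x -> creg 1 (iadd I x) z -> creg 1 (iadd I z) x.
Proof.
move=> /creg1P hx /creg1P hz; apply/creg1P => u /iaddP[v hv].
have /iaddP[w hw] : v \in iadd I x.
  apply: hz; apply/iaddP; exists u; rewrite -opprB; exact: idlN.
apply/iaddP; exists w; apply: hx.
have -> : (u - w * z) * x = (u * x - v * z) + z * (v - w * x) by ring.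
by apply: idlD => //; apply: idlMl.
Qed.

Lemma cregX I x n : creg 1 I x -> creg 1 I (x ^+ n).
Proof.
move=> /creg1P hx; apply/creg1P; elim: n => [|n IH] u; first by rewrite mulr1.
by rewrite exprS mulrA => /IH/hx.
Qed.

Lemma creg_pow_mod I x z n :
  creg 1 I x -> creg 1 (iadd I x) z -> creg 1 (iadd I (x ^+ n)) z.
Proof.
move=> hx /creg1P hz; apply/creg1P; elim: n => [|n IH] u hu.
  by apply/iaddP; exists u; rewrite mulr1 subrr; apply: idl0.
have /IH/iaddP[v hv] : u * z \in iadd I (x ^+ n).
  move/iaddP: hu => [r hr]; apply/iaddP; exists (r * x).
  by rewrite -mulrA -exprS.
move/iaddP: hu => [r hr].
have /hz/iaddP[w hw] : v * z \in iadd I x.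
  apply/iaddP; exists r; have /creg1P := @cregX _ _ n hx; apply.
  have -> : (v * z - r * x) * x ^+ n =
      (u * z - r * x ^+ n.+1) - z * (u - v * x ^+ n) by rewrite exprS; ring.
  by apply: idlB => //; apply: idlMl.
apply/iaddP; exists w.
have -> : u - w * x ^+ n.+1 = (u - v * x ^+ n) + (v - w * x) * x ^+ n.
  by rewrite exprS; ring.
by apply: idlD => //; apply: idlMr.
Qed.

Lemma reg_pow1 I x n s :
  creg 1 I x -> reg (iadd I x) s -> reg (iadd I (x ^+ n)) s.
Proof.
elim: s I => [|z s IH] I //= hx [hz hs]; split; first exact: creg_pow_mod hz.
rewrite iaddAC; apply: IH; first exact: creg_swap hz.
by rewrite iaddAC.
Qed.

Lemma reg_pow I s (a : seq nat) : size a = size s -> reg I s ->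
  reg I [seq p.1 ^+ p.2 | p <- zip s a].
Proof.
elim: s a I => [|x s IH] [|k a] I //= [sa] [hx hs]; split; first exact: cregX.
by apply: IH => //; apply: reg_pow1.
Qed.

Definition is_local (m : ideal R) : Prop :=
  1 \notin m /\ forall J, 1 \notin J -> {subset J <= m}.

Variable m : ideal R.
Hypotheses (noethR : noetherian R) (locm : is_local m).

Lemma local_unit u : u \notin m -> exists v, v * u = 1.
Proof.
move=> um; have [/iaddP[v]|h] := boolP (1 \in iadd idl_zero u).
  by move/in_zero/eqP; rewrite subr_eq0 => /eqP E; exists v.
by case/negP: um; apply: (locm.2 _ h); apply: iadd_in.
Qed.

Lemma prime_sub_local P : isprime P -> {subset P <= m}.
Proof. by case=> P1 _; apply: locm.2. Qed.

Lemma local_cancel b w r u : w \in m -> u - r * w * u \in b -> u \in b.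
Proof.
move=> wm h; have [|v hv] := @local_unit (1 - r * w).
  apply/negP => h1; case/negP: locm.1; rewrite -[1](subrK (r * w)).
  by apply: idlD => //; apply: idlMl.
have -> : u = v * (u - r * w * u).
  by rewrite -[X in X - _]mul1r -mulrBl mulrA hv mul1r.
exact: idlMl.
Qed.

Definition depthge b n : Prop :=
  exists s, [/\ size s = n, {subset s <= m} & reg b s].

Lemma ass_nreg b Q z : ass b Q -> {subset m <= Q} -> z \in m -> ~ creg 1 b z.
Proof.
move=> Qa mQ zm /creg1P hz; have [v vb Qv] := ass_wit Qa.
move/negP: vb; apply; apply: hz; rewrite mulrC.
by have := mQ _ zm; rewrite Qv => /colonP.
Qed.

(** The socles of [R/(b + z)] and [R/(b + w)] are isomorphic when [z] and [w]
    are both regular modulo [b]: [z u = w v] matches [u] with [v]. *)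
Lemma socle_transfer b z w Q : z \in m -> creg 1 b z -> creg 1 b w ->
  ass (iadd b w) Q -> {subset m <= Q} ->
  exists2 v, v \notin iadd b z & forall r, r \in m -> r * v \in iadd b z.
Proof.
move=> zm /creg1P hz /creg1P hw Qa mQ; have [u ub Qu] := ass_wit Qa.
have mu r : r \in m -> r * u \in iadd b w.
  by move/mQ; rewrite Qu => /colonP.
have /iaddP[v hv] := mu _ zm.
exists v.
  apply/negP => /iaddP[v' hv']; move/negP: ub; apply; apply/iaddP; exists v'.
  apply: hz; have -> : (u - v' * w) * z = (z * u - v * w) + w * (v - v' * z) by ring.
  by apply: idlD => //; apply: idlMl.
move=> r /mu/iaddP[u' hu']; apply/iaddP; exists u'; apply: hw.
have -> : (r * v - u' * z) * w = z * (r * u - u' * w) - r * (z * u - v * w) by ring.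
by apply: idlB; apply: idlMl.
Qed.

(** Let [z] be the first element of the given sequence. A common element [t],
    regular modulo both [b + w] and [b + z], lets the induction pass from [b] to
    [b + t]; it exists by the comparison of socles. *)
Lemma depthge_cut n b w : w \in m -> creg 1 b w ->
  depthge b n.+1 -> depthge (iadd b w) n.
Proof.
elim: n b w => [|n IH] b w wm hw; first by exists [::].
move=> [[|z1 [|z2 s]] [//= [sz] sm [hz1 [hz2 hs]]]].
have z1m : z1 \in m by apply: sm; rewrite mem_head.
have z2m : z2 \in m by apply: sm; rewrite !in_cons eqxx orbT.
have [|t tm [tw tz]] := @exists_creg0 _ noethR (iadd b w) (iadd b z1) m.
  move=> Q [] Qa mQ; last exact: ass_nreg Qa mQ z2m hz2.
  have [v vb hv] := socle_transfer z1m hz1 hw Qa mQ.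
  by move/negP: vb; apply; move/creg1P: hz2; apply; rewrite mulrC; apply: hv.
have h1 : depthge (iadd (iadd b z1) t) n.
  apply: IH => //; exists (z2 :: s); split=> //=; first by rewrite sz.
  by move=> u us; apply: sm; rewrite in_cons us orbT.
have [s1 [sz1 s1m hs1]] : depthge (iadd (iadd b t) w) n.
  apply: IH => //; first exact: creg_swap tw.
  case: h1 => s1 [sz1 s1m hs1]; exists (z1 :: s1); split=> /=.
  - by rewrite sz1.
  - by move=> u; rewrite in_cons => /orP[/eqP->|/s1m].
  - by split; [apply: creg_swap tz | rewrite iaddAC].
exists (t :: s1); split=> /=; first by rewrite sz1.
  by move=> u; rewrite in_cons => /orP[/eqP->|/s1m].
by rewrite iaddAC in hs1; split.
Qed.

Lemma depthge_adds n b s : {subset s <= m} -> reg b s ->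
  depthge b (size s + n) -> depthge (adds b s) n.
Proof.
elim: s b => [|x s IH] b //= sm [hx hs] h; apply: IH => //.
  by move=> u us; apply: sm; rewrite in_cons us orbT.
by apply: depthge_cut => //; apply: sm; rewrite mem_head.
Qed.

(** If [Q = b : v] and [t] is regular modulo [b], then [Q + t] lies in an
    associated prime of [b + t]: by Nakayama's lemma [b : Q] is not contained
    in [b + t]. *)
Lemma ass_cut b Q t : t \in m -> creg 1 b t -> ass b Q ->
  exists2 Q', ass (iadd b t) Q' & {subset iadd Q t <= Q'}.
Proof.
move=> tm /creg1P ht Qa; have [v vb Qv] := ass_wit Qa.
pose U u := forall r, r \in Q -> r * u \in b.
have Uv : U v by move=> r; rewrite Qv => /colonP.
have [[u Uu ub]|h] := pselect (exists2 u, U u & u \notin iadd b t).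
  have [Q' Q'a hQ'] := ass_exists noethR ub.
  exists Q' => //; apply: iadd_le.
    by move=> r /Uu ru; apply: hQ'; apply/colonP; apply: iadd_sub.
  by apply: (ass_sub Q'a); apply: iadd_in.
(* Now [U] lies in [b + t U]: an element [u = t w] of [U] with [b + (u)] maximal
   gives [w] in [b + (u)], hence [w (1 - r t)] in [b]. *)
exfalso; pose T J := exists u, [/\ U u, u \notin b & J = iadd b u].
have [J [[u [Uu ub ->]] _ Jmax]] := @noeth_max _ noethR T _
  (ex_intro _ v (And3 Uv vb (erefl _))).
have /iaddP[w hw] : u \in iadd b t.
  by apply: contrapT => /negP ut; apply: h; exists u.
have Uw : U w.
  move=> r rQ; apply: ht.
  have -> : r * w * t = r * u - r * (u - w * t) by ring.
  by apply: idlB; [apply: Uu | apply: idlMl].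
have wb : w \notin b.
  by apply: contra ub => wb; apply: idl_sub hw _; apply: idlMr.
have : w \in iadd b u.
  rewrite -(Jmax (iadd b w)); first exact: iadd_in.
    by exists w.
  apply: iadd_le; first exact: iadd_sub.
  apply/iaddP; exists t; by rewrite mulrC.
move/iaddP => [r hr]; move/negP: wb; apply; apply: (@local_cancel b t r) => //.
have -> : w - r * t * w = (w - r * u) + r * (u - w * t) by ring.
by apply: idlD => //; apply: idlMl.
Qed.

(** Some [t] in [x + (Q, xs)] is regular modulo [b]. Cutting by [t] lowers the depth
    by at most one, and an associated prime of [b + t] over [Q + t] takes the place
    of [Q]: modulo that prime, [xs] generates the maximal ideal up to radical. *)
Lemma depthge_ass n xs b Q : depthge b n -> ass b Q -> {subset xs <= m} ->
  (forall u, u \in m -> exists k, u ^+ k \in adds Q xs) -> (n <= size xs)%N.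
Proof.
elim: xs n b Q => [|x xs IH] [|n] b Q //= hb Qa xsm hm.
  have Qp := Qa.1; case: hb => -[|z s] [//= _ sm [hz _]].
  case: (ass_nreg Qa _ (sm _ (mem_head _ _)) hz) => u /hm[k].
  exact: isprimeX.
have xm : x \in m by apply: xsm; rewrite mem_head.
have {}xsm : {subset xs <= m} by move=> u us; apply: xsm; rewrite in_cons us orbT.
have Qm := prime_sub_local Qa.1.
have [|j jJ ht] := @exists_creg _ noethR b (adds Q xs) x.
  move=> Q1 Q1a xQ1 hQ1.
  have mQ1 : {subset m <= Q1}.
    move=> u /hm[k hk]; apply: (isprimeX (n := k) Q1a.1).
    move: hk; rewrite adds_iadd; move: (u ^+ k); exact: iadd_le.
  case: hb => -[|z s] [//= _ sm [hz _]].
  exact: ass_nreg Q1a mQ1 (sm _ (mem_head _ _)) hz.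
have tm : x + j \in m.
  by apply: idlD => //; move: jJ; apply: adds_le.
have [Q' Q'a hQ'] := ass_cut tm ht Qa.
rewrite ltnS; apply: (IH _ _ _ (depthge_cut tm ht hb) Q'a) => // u /hm[k hk].
exists k; move: hk; rewrite adds_iadd; move: (u ^+ k); apply: iadd_le.
  by apply: addsS => r rQ; apply: hQ'; apply: iadd_sub.
rewrite -[x](addrK j); apply: idlB.
  by apply: adds_sub; apply: hQ'; apply: iadd_in.
by move: jJ; apply: addsS => r rQ; apply: hQ'; apply: iadd_sub.
Qed.

End Depth.

(** * Uniform annihilators *)

Section Killers.
Variable R : comNzRingType.
Implicit Types (l a b P Q : ideal R) (c u v w x z : R) (s : seq R) (ps : seq (ideal R)).

(** Multiplication by [w] makes [0 -> R/l -> R/a -> R/(a + w) -> 0] exact up to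
    a factor [c]. *)
Definition cexact c l a w : Prop :=
  (forall u, u \in l -> u * w \in a) /\ (forall u, u * w \in a -> c * u \in l).

Lemma good_expr c a s k : good c a s -> good (c ^+ k.+1) a s.
Proof. by rewrite exprSr; apply: good_mulr. Qed.

(** Reduction modulo [x] keeps the sequence exact when [x] is regular on
    [R/(a + w)]: up to [c], this is the vanishing of Tor_1(R/(a + w), R/x). *)
Lemma cexact_step c l a w x : creg c (iadd a w) x -> cexact c l a w ->
  cexact (c ^+ 2) (iadd l x) (iadd a x) w.
Proof.
move=> hx [h1 h2]; split=> u /iaddP[t ht]; apply/iaddP.
  exists (t * w); have -> : u * w - t * w * x = (u - t * x) * w by ring.
  exact: h1.
have /iaddP[r hr] : c * t \in iadd a w.
  apply: hx; apply/iaddP; exists u; rewrite -opprB; exact: idlN.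
exists (c * r); have -> : c ^+ 2 * u - c * r * x = c * (c * u - r * x) by ring.
apply: h2.
have -> : (c * u - r * x) * w = c * (u * w - t * x) + x * (c * t - r * w) by ring.
by apply: idlD; apply: idlMl.
Qed.

(** In an exact sequence, regularity of the two ends up to [c] gives regularity of
    the middle term up to [c ^ 3], and each step of the sequence repeats this. *)
Lemma good_ext s c l a w : cexact c l a w -> good c l s ->
  good c (iadd a w) s -> good (c ^+ (3 ^ size s)) a s.
Proof.
elim: s c l a => [|x s IH] c l a //= hex [hlx hl] [hwx hw].
split; last first.
  rewrite expnS exprM; apply: (IH (c ^+ 3) (iadd l x)).
  - have -> : c ^+ 3 = c ^+ 2 * c by ring.
    have [h1 h2] := cexact_step hwx hex.
    by split=> // u /h2 h; rewrite mulrAC mulrC; apply: idlMl.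
  - exact: good_expr.
  - by rewrite iaddAC; apply: good_expr.
have [h1 h2] := hex.
move=> u ux; suff h : c ^+ 3 * u \in a.
  have k3 : (3 <= 3 ^ (size s).+1)%N by rewrite expnS leq_pmulr // expn_gt0.
  by rewrite -(subnK k3) exprD -mulrA; apply: idlMl.
have /iaddP[v hv] : c * u \in iadd a w by apply: hwx; apply: iadd_sub.
have : c * (c * v) \in l.
  apply: hlx; rewrite -mulrA; apply: h2.
  have -> : v * x * w = c * (u * x) - x * (c * u - v * w) by ring.
  by apply: idlB; apply: idlMl.
move/h1 => h.
have -> : c ^+ 3 * u = c ^+ 2 * (c * u - v * w) + c * (c * v) * w by ring.
by apply: idlD => //; apply: idlMl.
Qed.

(** The depth lemma: the kernel of [R/a -> R/(a + w)] is regular on one more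
    element than the quotient is. *)
Lemma good_lift s z c l a w : cexact c l a w -> reg a (rcons s z) ->
  good c (iadd a w) s -> good (c ^+ (3 ^ size s)) l (rcons s z).
Proof.
have base k c' l' a' x : cexact c' l' a' w -> creg 1 a' x ->
    creg (c' ^+ (3 ^ k)) l' x.
  move=> [h1 h2] /creg1P hx u /h1 h; rewrite -(@prednK (3 ^ k)) ?expn_gt0 //.
  rewrite exprSr -mulrA; apply: idlMl; apply: h2; apply: hx.
  by rewrite mulrAC.
elim: s c l a => [|x s IH] c l a //= hex [hx hs]; first by split=> //; apply: base hex hx.
move=> [hwx hw]; split; first exact: base hex hx.
rewrite expnS exprM; apply: (IH (c ^+ 3) _ (iadd a x)) => //.
  have [h1 h2] := cexact_step hwx hex.
  split=> // u /h2 h.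
  have -> : c ^+ 3 * u = c * (c ^+ 2 * u) by ring.
  exact: idlMl.
by rewrite iaddAC; apply: good_expr.
Qed.

Lemma colon_cexact a w : cexact 1 (colon a w) a w.
Proof. by split=> u; [move/colonP | rewrite mul1r => h; apply/colonP]. Qed.

Lemma cexact1 c l a w : cexact 1 l a w -> cexact c l a w.
Proof. by move=> [h1 h2]; split=> // u /h2; rewrite mul1r; apply: idlMl. Qed.

Hypothesis noethR : noetherian R.
Variables (b : ideal R) (ps : seq (ideal R)).
Hypothesis ps_prime : forall P, in_list P ps -> isprime P.
Hypothesis ps_sub : forall P, in_list P ps -> {subset b <= P}.
Hypothesis ps_min : forall P, in_list P ps ->
  forall Q, isprime Q -> {subset b <= Q} -> {subset Q <= P} -> Q = P.

Definition off c : Prop := forall P, in_list P ps -> c \notin P.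

Lemma off1 : off 1.
Proof. by move=> P /ps_prime[]. Qed.

Lemma offM c c' : off c -> off c' -> off (c * c').
Proof.
move=> h h' P hP; apply/negP => /(ps_prime hP).2.
by case; apply/negP; [apply: h | apply: h'].
Qed.

Lemma offX c n : off c -> off (c ^+ n).
Proof.
by move=> h; elim: n => [|n IH]; [apply: off1 | rewrite exprS; apply: offM].
Qed.

(** Uniform annihilators: modulo any ideal [a] over [b], one element [c] outside
    the given minimal primes of [b] makes all [b]-regular sequences of length
    [j] regular up to [c].

    Induction on [j]. A minimal prime [P = b : w] embeds [R/P] in [R/b] with
    quotient [R/(b + w)], so the depth lemma gains one step for [R/P]. A prime
    [Q] over [b] that is not listed meets the complement, so [R/Q] is killed.
    Noetherian induction over extensions by [R/Q] handles all [a]. *)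
Lemma uniform_killer j a : {subset b <= a} -> exists2 c, off c &
  forall s, size s = j -> reg b s -> good c a s.
Proof.
elim: j a => [|j IHj] a ba; first by exists 1; [apply: off1 | case].
have prime_case P : in_list P ps -> exists2 c, off c &
    forall s, size s = j.+1 -> reg b s -> good c P s.
  move=> Pin; have [_ [w Pw]] := min_ass noethR (ps_prime Pin) (ps_sub Pin) (ps_min Pin).
  have [c hc h] := IHj (iadd b w) (@iadd_sub _ _ _).
  exists (c ^+ (3 ^ j)); first exact: offX.
  move=> s; case/lastP: s => [//|s z]; rewrite size_rcons => -[ss] hs.
  rewrite -ss; apply: (good_lift (a := b) (w := w)) => //.
    by rewrite Pw; apply: cexact1; apply: colon_cexact.
  apply: h => //; move: hs; rewrite -cats1 => /good_cat[]//.
apply: contrapT => na.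
have [J [[bJ nJ] _ Jmax]] := @noeth_max _ noethR (fun a => {subset b <= a} /\
  ~ exists2 c, off c & forall s, size s = j.+1 -> reg b s -> good c a s) a (conj ba na).
apply: nJ; have [J1|J1] := boolP (1 \in J).
  by exists 1; [apply: off1 | move=> s _ _; apply: good_ann].
have [Q Qa _] := ass_exists noethR J1.
have [w wJ Qw] := ass_wit Qa.
have [c1 hc1 h1] : exists2 c, off c &
    forall s, size s = j.+1 -> reg b s -> good c (iadd J w) s.
  apply: contrapT => h; case/negP: wJ.
  rewrite -(Jmax (iadd J w)); [exact: iadd_in | | exact: iadd_sub].
  by split=> // u /bJ; apply: iadd_sub.
have bQ : {subset b <= Q} by move=> u /bJ; apply: (ass_sub Qa).
have [c2 hc2 h2] : exists2 c, off c &
    forall s, size s = j.+1 -> reg b s -> good c Q s.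
  have [[P Pin QP]|h] := pselect (exists2 P, in_list P ps & {subset Q <= P}).
    by rewrite (ps_min Pin Qa.1 bQ QP); apply: prime_case.
  have [|P Pin _ QP|q qQ hq] := @coset_avoid _ ps Q 0; first exact: ps_prime.
    by apply: h; exists P.
  exists q; first by move=> P Pin; rewrite -[q]add0r; apply: hq.
  by move=> s _ _; apply: good_ann.
exists ((c1 * c2) ^+ (3 ^ j.+1)); first by apply: offX; apply: offM.
move=> s ss hs; rewrite -ss; apply: (good_ext (l := Q) (w := w)).
- by rewrite Qw; apply: cexact1; apply: colon_cexact.
- by apply: good_mulr; apply: h2.
- by rewrite mulrC; apply: good_mulr; apply: h1.
Qed.

End Killers.

(** * Regular lifts of systems of parameters *)

Section Preimage.
Variables (L R : comNzRingType) (g : {rmorphism L -> R}).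
Implicit Types (I : ideal R).

Lemma preim0 I : g 0 \in I. Proof. by rewrite rmorph0; apply: idl0. Qed.
Lemma preimS I (r u v : L) : g u \in I -> g v \in I -> g (r * u + v) \in I.
Proof. by move=> hu hv; rewrite rmorphD rmorphM; apply: idlD => //; apply: idlMl. Qed.

Definition preimi I : ideal L :=
  @mk_ideal L (fun u => g u \in I) (@preim0 I) (@preimS I).

Lemma preimP I u : u \in preimi I <-> g u \in I.
Proof. exact: (@mk_idealP L (fun u => g u \in I)). Qed.

Lemma preim_prime I : isprime I -> isprime (preimi I).
Proof.
move=> [I1 Ip]; split; first by apply/negP => /preimP; rewrite rmorph1; apply/negP.
by move=> u v /preimP; rewrite rmorphM => /Ip[] h; [left | right]; apply/preimP.
Qed.

Hypothesis g_surj : forall y, exists x, g x = y.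

Lemma preim_inj_sub I J : {subset preimi I <= preimi J} -> {subset I <= J}.
Proof. by move=> h y; have [x <-] := g_surj y => /preimP/h/preimP. Qed.

Lemma preim_iadd I x : iadd (preimi I) x = preimi (iadd I (g x)).
Proof.
apply: ideal_eq => u.
  move/iaddP => [r /preimP hr]; apply/preimP/iaddP; exists (g r).
  by rewrite -rmorphM -rmorphB.
move/preimP/iaddP => [r]; have [r' <-] := g_surj r => hr.
by apply/iaddP; exists r'; apply/preimP; rewrite rmorphB rmorphM.
Qed.

Lemma preim_adds I s : adds (preimi I) s = preimi (adds I (map g s)).
Proof. by elim: s I => [|x s IH] I //=; rewrite preim_iadd IH. Qed.

Lemma good_preim c I s : good c (preimi I) s -> good (g c) I (map g s).
Proof.
elim: s I => [|x s IH] I //= [hx hs]; split; last by apply: IH; rewrite -preim_iadd.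
move=> u; have [u' <-] := g_surj u => hu.
by rewrite -rmorphM; apply/preimP/hx/preimP; rewrite rmorphM.
Qed.

End Preimage.

Section Height.
Variable R : comNzRingType.
Implicit Types (P Q b : ideal R) (s : seq R).

Fixpoint height_ge n P : Prop :=
  isprime P /\ if n is n'.+1 then
    exists Q, [/\ {subset Q <= P}, ~ {subset P <= Q} & height_ge n' Q] else True.

Lemma height_ge_le n P P' : isprime P' -> {subset P <= P'} -> height_ge n P -> height_ge n P'.
Proof.
case: n => [|n] //= pP' PP' [_ [Q [QP PQ hQ]]]; split=> //; exists Q; split=> //.
  by move=> u /QP/PP'.
by move=> P'Q; apply: PQ => u /PP'/P'Q.
Qed.

Lemma height_ge_chain n P k (Q : nat -> ideal R) : height_ge n P -> {subset P <= Q 0%N} ->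
  (forall i, isprime (Q i)) ->
  (forall i, (i < k)%N -> {subset Q i <= Q i.+1} /\ ~ {subset Q i.+1 <= Q i}) ->
  height_ge (n + k) (Q k).
Proof.
move=> hP PQ Qp; elim: k => [|k IH] hQ; first by rewrite addn0; apply: height_ge_le hP.
rewrite addnS; split=> //; exists (Q k); have [h1 h2] := hQ k (ltnSn k).
by split=> //; apply: IH => i ik; apply: hQ; apply: ltnW.
Qed.

(** A regular sequence of length [n] in [P] forces height at least [n]: its last
    element avoids the associated primes of the ideal of the others, one of
    which lies inside [P]. *)
Lemma reg_height b s P : noetherian R -> reg b s -> isprime P ->
  {subset adds b s <= P} -> height_ge (size s) P.
Proof.
move=> noethR; elim/last_ind: s P => [|s z IH] P /=; first by [].
rewrite size_rcons -cats1 => /good_cat[hs [hz _]] Pp.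
rewrite adds_cat /= => sP.
have [|Q Qa QP] := ass_below noethR Pp (I := adds b s).
  by move=> u us; apply: sP; apply: iadd_sub.
split=> //; exists Q; split=> //; last first.
  by apply: IH => //; [case: Qa | apply: ass_sub].
move=> PQ; have [v vs Qv] := ass_wit Qa; case/negP: vs.
move/creg1P: hz; apply; rewrite mulrC.
have : z \in Q by apply/PQ/sP/iadd_in.
by rewrite Qv => /colonP.
Qed.

Definition min_prime P : Prop :=
  isprime P /\ forall Q, isprime Q -> {subset Q <= P} -> Q = P.

Lemma sub0i (I : ideal R) : {subset (idl_zero : ideal R) <= I}.
Proof. by move=> u /in_zero->; apply: idl0. Qed.

End Height.

Section ColonKiller.
Variables (L R : comNzRingType) (g : {rmorphism L -> R}).
Hypothesis g_surj : forall y, exists x, g x = y.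
Variables (mL : ideal L) (mR : ideal R) (D d : nat).
Hypotheses (noethL : noetherian L) (locL : is_local mL).
Hypotheses (noethR : noetherian R) (locR : is_local mR).
Hypothesis depthL : depthge mL idl_zero D.
Hypothesis dimL : forall (P : ideal L) n, height_ge n P -> (n <= D)%N.
Hypothesis equidimR : forall P : ideal R, min_prime P -> exists Q : nat -> ideal R,
  [/\ {subset P <= Q 0%N}, forall i, isprime (Q i)
    & forall i, (i < d)%N -> {subset Q i <= Q i.+1} /\ ~ {subset Q i.+1 <= Q i}].
Hypothesis exists_min_prime : exists P : ideal R, min_prime P.

Let J := preimi g idl_zero.

(** As [1] is not in the kernel, which thus lies in [mL], no unit of [R] comes from
    [mL]. *)
Lemma preim_max u : u \in mL <-> g u \in mR.
Proof.
split=> [um|]; last first.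
  move=> h; apply: (locL.2 (preimi g mR)); last exact/preimP.
  by apply/negP => /preimP; rewrite rmorph1; apply/negP; case: locR.
apply: contrapT => /negP/(local_unit locR)[v].
have [v' <-] := g_surj v => E.
have : v' * u - 1 \in mL.
  apply: (locL.2 J); last by apply/preimP/in_zero; rewrite rmorphB rmorphM E rmorph1 subrr.
  by apply/negP => /preimP/in_zero; rewrite rmorph1 => /eqP; rewrite oner_eq0.
move/idl_subr => /(_ (idlMl _ um)); apply/negP; by case: locL.
Qed.

Lemma max_pow (xs : seq L) (Q : ideal L) : {subset J <= Q} ->
  (forall u, u \in mR -> exists k, u ^+ k \in ideal_gen (map g xs)) ->
  forall u, u \in mL -> exists k, u ^+ k \in adds Q xs.
Proof.
move=> JQ h u /preim_max/h[k]; rewrite gen_adds => hk; exists k.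
by apply: (addsS JQ); rewrite preim_adds //; apply/preimP; rewrite rmorphXn.
Qed.

(** A chain below [preimi g P] followed by a chain of length [d] above it is a
    chain of primes of [L]. *)
Lemma min_prime_height (P : ideal R) (Q : ideal L) n : min_prime P -> height_ge n Q ->
  {subset Q <= preimi g P} -> (n + d <= D)%N.
Proof.
move=> hP hQ QP; have [C [C0 Cp CS]] := equidimR hP.
apply: (dimL (P := preimi g (C d))).
apply: (height_ge_chain (P := Q) (Q := fun i => preimi g (C i))) => //.
- by move=> u /QP/preimP/C0 ?; apply/preimP.
- by move=> i; apply: preim_prime.
- move=> i /CS[h1 h2]; split; last by move/(preim_inj_sub g_surj).
  by move=> u /preimP/h1 ?; apply/preimP.
Qed.

(** Lifts of a system of parameters of [R] can be corrected by elements of the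
    kernel so as to become regular modulo [b]: otherwise [J] and the next
    parameter lie in an associated prime of [b], contradicting the bound of the
    depth by the number of remaining generators. *)
Lemma regular_lift (xs : seq L) (b : ideal L) : {subset xs <= mL} ->
  depthge mL b (size xs) ->
  (forall Q : ideal L, {subset J <= Q} -> {subset b <= Q} ->
    forall u, u \in mL -> exists k, u ^+ k \in adds Q xs) ->
  exists2 ys, map g ys = map g xs & reg b ys.
Proof.
elim: xs b => [|x xs IH] b /= xm hb hQ; first by exists [::].
have Jm : {subset J <= mL}.
  by move=> u /preimP/in_zero gu; apply/preim_max; rewrite gu; apply: idl0.
have [|j jJ hj] := @exists_creg _ noethL b J x.
  move=> Q Qa xQ JQ.
  have := depthge_ass noethL locL (xs := xs) hb Qa; rewrite ltnn => h.
  suff : false by [].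
  apply: h => [u us|u]; first by apply: xm; rewrite in_cons us orbT.
  by move/(hQ Q JQ (ass_sub Qa)) => [k]; rewrite iadd_id //; exists k.
have xjm : x + j \in mL by apply: idlD; [apply: xm; rewrite mem_head | apply: Jm].
have [|||ys Eys hys] := IH (iadd b (x + j)).
- by move=> u us; apply: xm; rewrite in_cons us orbT.
- exact: depthge_cut.
- move=> Q JQ bQ u um.
  have [|k] := hQ Q JQ _ u um; first by move=> v vb; apply: bQ; apply: iadd_sub.
  rewrite iadd_id; first by exists k.
  by rewrite -[x](addrK j); apply: idlB; [apply/bQ/iadd_in | apply: JQ].
exists (x + j :: ys); last by split.
by rewrite /= Eys rmorphD; move/preimP/in_zero: jJ => ->; rewrite addr0.
Qed.

(** One element [c] off the minimal primes of [R] makes all powers of a system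
    of parameters a regular sequence up to [c].

    A maximal [L]-regular sequence [y] inside the kernel [J] has length
    [D - d]: at least, by the depth bound for an associated prime of [(y)] that
    contains [J]; at most, because every minimal prime of [J] has dimension [d]
    and height at least the length of [y]. The same count shows that the minimal
    primes of [J] are minimal over [(y)], so the uniform annihilators apply. *)
Lemma parameter_killer (x : seq R) : size x = d -> {subset x <= mR} ->
  (forall u, u \in mR -> exists k, u ^+ k \in ideal_gen x) ->
  exists2 c : R, (forall P, min_prime P -> c \notin P) &
  forall a, size a = d -> good c idl_zero [seq p.1 ^+ p.2 | p <- zip x a].
Proof.
move=> sx xm hx.
have [P0 P0min] := exists_min_prime.
have JP (P : ideal R) : {subset J <= preimi g P}.
  by move=> u /preimP/in_zero gu; apply/preimP; rewrite gu; apply: idl0.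
have ybound (y : seq L) : {subset y <= J} -> reg idl_zero y -> (size y + d <= D)%N.
  move=> yJ hy; apply: (min_prime_height P0min (Q := preimi g P0)) => //.
  apply: (reg_height noethL hy); first by apply: preim_prime; case: P0min.
  by apply: adds_le (sub0i _) _ => u /yJ/JP.
pose T n := `[< exists y : seq L, [/\ size y = n, {subset y <= J} & reg idl_zero y] >].
have exT : exists n, T n by exists 0%N; apply/asboolP; exists [::].
have Tle n : T n -> (n <= D)%N.
  move=> /asboolP[y [<- yJ hy]]; apply: leq_trans (ybound _ yJ hy); exact: leq_addr.
case: (ex_maxnP exT Tle) => h /asboolP[y [sy yJ hy]] hmax.
pose b := adds idl_zero y.
have Jm : {subset J <= mL}.
  by move=> u /preimP/in_zero gu; apply/preim_max; rewrite gu; apply: idl0.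
have hD : (h + d <= D)%N by rewrite -sy; apply: ybound.
have depb : depthge mL b (D - h).
  apply: depthge_adds => //; first by move=> u /yJ/Jm.
  by rewrite sy subnKC //; apply: leq_trans hD; apply: leq_addr.
have [xl xlx] : exists xl, map g xl = x.
  elim: x {sx xm hx} => [|z x [xl <-]]; first by exists [::].
  by have [z' <-] := g_surj z; exists (z' :: xl).
have xlm : {subset xl <= mL}.
  by move=> u us; apply/preim_max; apply: xm; rewrite -xlx; apply: map_f.
have sxl : size xl = d by rewrite -sx -xlx size_map.
have hxl (Q : ideal L) : {subset J <= Q} ->
    forall u, u \in mL -> exists k, u ^+ k \in adds Q xl.
  by move=> JQ; apply: max_pow; rewrite // xlx.
(* By maximality of [y], the kernel lies in an associated prime of [b]. *)
have Dhd : (D - h <= d)%N.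
  have [[Q Qa JQ]|nQ] := pselect (exists2 Q, ass b Q & {subset J <= Q}).
    by rewrite -sxl; apply: (depthge_ass noethL locL depb Qa xlm); apply: hxl.
  have [Q Qa _ JQ|j jJ hj] := @exists_creg _ noethL b J 0; first by apply: nQ; exists Q.
  rewrite add0r in hj; suff /hmax : T h.+1 by rewrite ltnn.
  apply/asboolP; exists (rcons y j); split; first by rewrite size_rcons sy.
    by move=> u; rewrite mem_rcons in_cons => /orP[/eqP->|/yJ].
  by rewrite -cats1; apply/good_cat; split.
have {}depb : depthge mL b (size xl).
  by rewrite sxl; have -> : d = (D - h)%N by lia.
have [|ys Eys hys] := @regular_lift xl b xlm depb.
  by move=> Q JQ _; apply: hxl.
have [rs hrs] := ass_finite noethR idl_zero.
pose ps := map (preimi g) [seq P <- rs | `[< min_prime P >]].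
have psP Q : in_list Q ps -> exists2 P, min_prime P & Q = preimi g P.
  rewrite /ps; elim: rs {hrs ps} => [|P rs IH] //=.
  by case: asboolP => [hP|_] //= [->|/IH//]; exists P.
have psin P : min_prime P -> in_list (preimi g P) ps.
  move=> hP; have : in_list P rs.
    apply: hrs; apply: (min_ass noethR hP.1 (sub0i _)) => Q Qp _; exact: hP.2.
  rewrite /ps; elim: (rs) => [|P' rs' IH] //= [<-|/IH].
    by case: asboolP => //= _; left.
  by case: asboolP => //= _; right.
have bJ : {subset b <= J} by apply: adds_le (sub0i _) yJ.
have [c hc hgood] : exists2 c, off ps c &
    forall s, size s = d -> reg b s -> good c J s.
  apply: uniform_killer (bJ) => //.
  - by move=> Q /psP[P [Pp _] ->]; apply: preim_prime.
  - by move=> Q /psP[P [Pp _] ->] u /bJ/JP.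
  (* A prime over [b] strictly below [preimi g P] has height at least [h], which
     leaves no room for [h + 1 + d <= D]. *)
  - move=> Q /psP[P Pm ->] Q' Q'p bQ' Q'P; apply: ideal_eq => //.
    apply: contrapT => PQ'.
    have hQ' : height_ge h Q' by rewrite -sy; apply: (reg_height noethL hy).
    have : height_ge h.+1 (preimi g P).
      by split; [apply: preim_prime; case: Pm | exists Q'].
    by move/(min_prime_height Pm) => /(_ (fun u hu => hu)); lia.
exists (g c).
  by move=> P /psin/hc; apply: contra => h'; apply/preimP.
move=> a sa.
have -> : [seq p.1 ^+ p.2 | p <- zip x a] = map g [seq p.1 ^+ p.2 | p <- zip ys a].
  rewrite -xlx -Eys; elim: (ys) (a) => [|z zs IH] [|k k'] //=.
  by rewrite rmorphXn IH.
have sys : size ys = d by rewrite -sxl -(size_map g) Eys size_map.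
apply: good_preim => //; apply: hgood.
  by rewrite size_map size_zip sys sa minnn.
by apply: reg_pow; rewrite // sys.
Qed.

End ColonKiller.

(** * Prime ideals, heights and chains of primes *)

Section Conversions.
Variable R : comNzRingType.

Section OfIdealr.
Variable m : idealr R.
Lemma ideal_of0 : 0 \in m. Proof. exact: idealr0. Qed.
Lemma ideal_ofS r u v : u \in m -> v \in m -> r * u + v \in m.
Proof. by move=> um vm; rewrite rpredD // idealMr. Qed.
Definition ideal_of : ideal R :=
  @mk_ideal R (fun u => u \in m) ideal_of0 ideal_ofS.
Lemma ideal_ofE : ideal_of =i m.
Proof.
move=> u; apply/idP/idP; first by move/(@mk_idealP R (fun u => u \in m)).
by move=> h; apply/(@mk_idealP R (fun u => u \in m)).
Qed.
End OfIdealr.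

Lemma ideal_closed (I : ideal R) : 1 \notin I -> idealr_closed (fun u : R => u \in I).
Proof.
by split=> //; [apply: idl0 | move=> r u v uI vI; apply: idlD => //; apply: idlMl].
Qed.

Lemma to_idealr (I : ideal R) : 1 \notin I -> exists J : idealr R, J =i I.
Proof.
move=> /ideal_closed h.
pose J : idealr R := HB.pack (fun u : R => u \in I) (isIdealr.Build R (fun u : R => u \in I) h).
by exists J.
Qed.

Lemma to_prime_idealr (I : ideal R) : isprime I -> exists J : prime_idealr R, J =i I.
Proof.
move=> [/ideal_closed h Ip].
have hp : prime_idealr_closed (fun u : R => u \in I) by move=> u v /Ip/orP.
pose J : prime_idealr R := HB.pack (fun u : R => u \in I)
  (isIdealr.Build R (fun u : R => u \in I) h)
  (isPrimeIdealrClosed.Build R (fun u : R => u \in I) hp).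
by exists J.
Qed.

Lemma prime_ideal_of (P : prime_idealr R) : isprime (ideal_of P).
Proof.
split; first by rewrite ideal_ofE idealr1.
by move=> u v; rewrite !ideal_ofE prime_idealrM => /orP.
Qed.

Lemma min_prime_of_minimal (P : prime_idealr R) : minimal_prime P -> min_prime (ideal_of P).
Proof.
move=> Pmin; split=> [|Q Qp QP]; first exact: prime_ideal_of.
have [Q' Q'E] := to_prime_idealr Qp.
apply: ideal_eqi => u; rewrite ideal_ofE -(Pmin Q') ?Q'E // => v.
by rewrite Q'E => /QP; rewrite ideal_ofE.
Qed.

Lemma minimal_of_min_prime (P : ideal R) : min_prime P ->
  exists2 P' : prime_idealr R, minimal_prime P' & P' =i P.
Proof.
move=> [Pp Pmin]; have [P' P'E] := to_prime_idealr Pp; exists P' => // Q QP' u.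
rewrite P'E -(Pmin (ideal_of Q)) ?ideal_ofE //; first exact: prime_ideal_of.
by move=> v; rewrite ideal_ofE => /QP'; rewrite P'E.
Qed.

Lemma is_local_of (m : idealr R) : noetherian R -> local_ring m -> is_local (ideal_of m).
Proof.
move=> noethR [mmax muniq]; split; first by rewrite ideal_ofE idealr1.
move=> I I1; have [J [J1 IJ Jmax]] := @noeth_max _ noethR (fun J => 1 \notin J) I I1.
have [J' J'E] := to_idealr J1.
have /muniq J'm : maximal_ideal J'.
  move=> M J'M u; rewrite J'E -(Jmax (ideal_of M)) ?ideal_ofE ?idealr1 //.
  by move=> v; rewrite ideal_ofE -J'E => /J'M.
by move=> u /IJ; rewrite ideal_ofE -J'm J'E.
Qed.

Lemma height_ge_seq n (P : ideal R) : height_ge n P -> exists C : nat -> ideal R,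
  [/\ C n = P, forall i, isprime (C i)
    & forall i, (i < n)%N -> {subset C i <= C i.+1} /\ ~ {subset C i.+1 <= C i}].
Proof.
elim: n P => [|n IH] P /=; first by move=> [Pp _]; exists (fun=> P).
move=> [Pp [Q [QP PQ /IH[C [Cn Cp CS]]]]].
exists (fun i => if (i <= n)%N then C i else P); split.
- by rewrite ltnn.
- by move=> i; case: ifP.
- move=> i; rewrite ltnS => le_in; rewrite le_in.
  move: le_in; case: (ltngtP i n) => // [iltn _|-> _]; last by rewrite Cn.
  exact: CS.
Qed.

Lemma height_ge_krull D n (P : ideal R) : krull_dim R D -> height_ge n P -> (n <= D)%N.
Proof.
move=> [_ Dmax] /height_ge_seq[C [_ Cp CS]]; apply: Dmax.
have [C' C'E] := choice (fun i => to_prime_idealr (Cp i)).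
exists C' => i /CS[h1 h2]; split; first by move=> u; rewrite !C'E; apply: h1.
by move=> h; apply: h2 => u; rewrite -!C'E; apply: h.
Qed.

(** The bottom of a prime chain of maximal length is a minimal prime. *)
Lemma krull_min_prime D : krull_dim R D -> exists P : ideal R, min_prime P.
Proof.
move=> [[C CS] Dmax]; exists (ideal_of (C 0%N)); split; first exact: prime_ideal_of.
move=> Q Qp QC; apply: ideal_eq => //; apply: contrapT => CQ.
have [Q' Q'E] := to_prime_idealr Qp.
have /Dmax : prime_chain R D.+1.
  exists (fun i => if i is j.+1 then C j else Q') => -[|i] iD; last exact: CS.
  split; first by move=> u; rewrite Q'E => /QC; rewrite ideal_ofE.
  by move=> h; apply: CQ => u; rewrite ideal_ofE => /h; rewrite Q'E.
by rewrite ltnn.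
Qed.

Lemma regular_reg (I : ideal R) s :
  (forall i, (i < size s)%N -> forall a, s`_i * a \in adds I (take i s) ->
    a \in adds I (take i s)) -> reg I s.
Proof.
elim: s I => [|x s IH] I //= h; split.
  by apply/creg1P => u ux; apply: (h 0%N) => //=; rewrite mulrC.
by apply: IH => i is_ a; apply: (h i.+1).
Qed.

Lemma depth_depthge (n : idealr R) D : depth n D -> depthge (ideal_of n) idl_zero D.
Proof.
move=> [[s [ss sn [_ hs]]] _]; exists s; split=> //.
  by move=> u /sn; rewrite ideal_ofE.
by apply: regular_reg => i /hs h a; rewrite -!gen_adds; apply: h.
Qed.

End Conversions.

(** A maximal chain of primes of [R/P], pulled back to [R]. *)
Lemma equidim_chain (R : comNzRingType) d (P : ideal R) : equidimensional R ->
  krull_dim R d -> min_prime P -> exists Q : nat -> ideal R,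
  [/\ {subset P <= Q 0%N}, forall i, isprime (Q i)
    & forall i, (i < d)%N -> {subset Q i <= Q i.+1} /\ ~ {subset Q i.+1 <= Q i}].
Proof.
move=> hequi hd /minimal_of_min_prime[P' P'min P'E].
have [[C CS] _] := (hequi P' P'min d).2 hd.
pose pi : {rmorphism R -> {ideal_quot P'}} := \pi_{ideal_quot P'}%qT.
exists (fun i => preimi pi (ideal_of (C i))); split.
- move=> u; rewrite -P'E => uP; apply/preimP; rewrite ideal_ofE.
  have -> : pi u = 0; last exact: idealr0.
  by apply/eqP; rewrite -(rmorph0 pi) -Quotient.idealrBE subr0.
- by move=> i; apply: preim_prime; apply: prime_ideal_of.
have pis y : exists x, pi x = y by exists (repr y); apply: reprK.
move=> i /CS[h1 h2]; split.
  by move=> u /preimP hu; apply/preimP; rewrite !ideal_ofE in hu *; apply: h1.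
by move=> /(preim_inj_sub pis) h; apply: h2 => u; rewrite -!ideal_ofE; apply: h.
Qed.

(** * Localization and colon capturing *)

Section LocalizedSurjection.
Variables (S L R : comNzRingType) (f : {rmorphism S -> R}) (phi : {rmorphism S -> L}).
Variables (m : ideal R) (n : idealr S).
Hypotheses (locm : is_local m) (f_surj : forall y, exists x, f x = y).
Hypothesis nE : forall s, s \in n = (f s \in m).
Hypothesis hloc : is_localization n phi.

Let invertible s := exists v, v * f s = 1.

Lemma notin_invertible s : s \notin n <-> invertible s.
Proof.
rewrite nE; split=> [|[v vs]]; first exact: local_unit.
by apply/negP => /(idlMl v); rewrite vs; apply/negP; case: locm.
Qed.

Lemma invertible1 : invertible 1.
Proof. by exists 1; rewrite rmorph1 mul1r. Qed.

Lemma invertibleM s t : invertible s -> invertible t -> invertible (s * t).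
Proof.
by move=> [v hv] [w hw]; exists (v * w); rewrite rmorphM mulrACA hv hw mulr1.
Qed.

Lemma invertible_inj s y z : invertible s -> y * f s = z * f s -> y = z.
Proof.
move=> [v hv] E; have : v * (y * f s) = v * (z * f s) by rewrite E.
by rewrite !(mulrCA v) hv !mulr1.
Qed.

(* The graph of the factored map: [z = phi a / phi s] goes to [f a / f s]. *)
Let G z y := exists a s, [/\ invertible s, z * phi s = phi a & y * f s = f a].

Lemma G_total z : exists y, G z y.
Proof.
have [_ hfrac _] := hloc; have [a [s [/notin_invertible hs E]]] := hfrac z.
have [v hv] := hs; exists (f a * v), a, s; split=> //.
by rewrite -mulrA hv mulr1.
Qed.

Lemma G_fun z y y' : G z y -> G z y' -> y = y'.
Proof.
move=> [a [s [hs E1 E2]]] [a' [s' [hs' E1' E2']]].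
have [_ _ hker] := hloc.
have [t /notin_invertible ht E] : exists2 t, t \notin n & t * (a * s' - a' * s) = 0.
  by apply/hker; rewrite rmorphB !rmorphM -E1 -E1'; ring.
apply: (invertible_inj (invertibleM ht (invertibleM hs hs'))).
have : f (t * (a * s' - a' * s)) = 0 by rewrite E rmorph0.
rewrite !rmorphM rmorphB !rmorphM -E2 -E2' mulrBr => /eqP; rewrite subr_eq0 => /eqP E'.
transitivity (f t * (y * f s * f s')); first by ring.
by rewrite E'; ring.
Qed.

(** The complement of [n] maps to units of the local ring [R], so [f] factors
    through [L]. *)
Lemma localized_surjection : exists g : {rmorphism L -> R}, forall y, exists x, g x = y.
Proof.
have [g hg] := choice G_total.
have gE z y : G z y -> g z = y by apply: G_fun.
have gphi x : g (phi x) = f x.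
  by apply: gE; exists x, 1; rewrite !rmorph1 !mulr1; split=> //; apply: invertible1.
have gB : zmod_morphism g.
  move=> z z'; apply: gE; have [a [s [hs E1 E2]]] := hg z.
  have [a' [s' [hs' E1' E2']]] := hg z'.
  exists (a * s' - a' * s), (s * s'); split; first exact: invertibleM.
    by rewrite rmorphB !rmorphM -E1 -E1'; ring.
  by rewrite rmorphB !rmorphM -E2 -E2'; ring.
have gM : monoid_morphism g.
  split=> [|z z']; first by rewrite -(rmorph1 phi) gphi rmorph1.
  apply: gE; have [a [s [hs E1 E2]]] := hg z.
  have [a' [s' [hs' E1' E2']]] := hg z'.
  exists (a * a'), (s * s'); split; first exact: invertibleM.
    by rewrite !rmorphM -E1 -E1'; ring.
  by rewrite !rmorphM -E2 -E2'; ring.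
pose g' : {rmorphism L -> R} := HB.pack g
  (GRing.isZmodMorphism.Build L R g gB) (GRing.isMonoidMorphism.Build L R g gM).
by exists g' => y; have [x <-] := f_surj y; exists (phi x); apply: gphi.
Qed.

End LocalizedSurjection.

(** A system of parameters, as a sequence of generators of an ideal with
    radical [m]. *)
Definition is_param (R : comNzRingType) (m : ideal R) d (x : seq R) : Prop :=
  [/\ size x = d, {subset x <= m} &
      forall u, u \in m -> exists k, u ^+ k \in ideal_gen x].

(** The localization of the Cohen-Macaulay ring at the preimage of [m] maps onto
    [R], and [parameter_killer] applies to this surjection. *)
Lemma parameter_colon (R : comNzRingType) (m : idealr R) d (x : seq R) :
  noetherian R -> local_ring m -> equidimensional R -> image_of_cohen_macaulay R ->
  krull_dim R d -> is_param (ideal_of m) d x ->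
  exists2 c : R, Rcirc c & forall a, size a = d ->
    good c idl_zero [seq p.1 ^+ p.2 | p <- zip x a].
Proof.
move=> noethR locR hequi [S [f [[noethS hCM] f_surj]]] hd [sx xm hx].
have locm := is_local_of noethR locR.
have [n nE] : exists n : idealr S, forall s, s \in n = (f s \in ideal_of m).
  have [|n nE] := @to_idealr S (preimi f (ideal_of m)).
    by apply/negP => /preimP; rewrite rmorph1; apply/negP; case: locm.
  by exists n => s; rewrite nE; apply/idP/idP => /preimP.
have nmax : maximal_ideal n.
  move=> J nJ u; apply/idP/idP => [uJ|/nJ //].
  apply: contraT; rewrite nE => /(local_unit locm)[v].
  have [w <-] := f_surj v; rewrite -rmorphM => E.
  have : w * u - 1 \in J.
    by apply: nJ; rewrite nE rmorphB E rmorph1 subrr; apply: idl0.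
  move=> h; have : 1 \in J; last by rewrite idealr1.
  rewrite -[1](subKr (w * u)) rpredB //; exact: idealMr.
have [L [phi [nL [hloc [noethL locL [D dimL depL]]]]]] := hCM n nmax.
have [g gs] := localized_surjection locm f_surj nE hloc.
have [c hc hgood] := parameter_killer gs noethL (is_local_of noethL locL) noethR locm
  (depth_depthge depL) (fun P k => height_ge_krull dimL) (fun P => equidim_chain hequi hd)
  (krull_min_prime hd) sx xm hx.
by exists c => // P /min_prime_of_minimal/hc; rewrite ideal_ofE.
Qed.

(** * Lengths and chains of ideals *)

Section Chains.
Variable R : comNzRingType.
Implicit Types (a b c F G V B J : ideal R) (u v z : R).

Fixpoint chain n a b : Prop :=
  if n is n'.+1 then
    exists a', [/\ {subset a <= a'}, ~ {subset a' <= a} & chain n' a' b]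
  else {subset a <= b}.

Lemma chain_sub n a b : chain n a b -> {subset a <= b}.
Proof. by elim: n a => [|n IH] a //= [a' [aa' _ /IH a'b]] u /aa'/a'b. Qed.

Lemma chain_weak n a b a0 b0 :
  {subset a0 <= a} -> {subset b <= b0} -> chain n a b -> chain n a0 b0.
Proof.
elim: n a a0 => [|n IH] a a0 /= ha hb; first by move=> ab u /ha/ab/hb.
move=> [a' [aa' a'a h]]; exists a'; split.
- by move=> u /ha/aa'.
- by move=> a'a0; apply: a'a => u /a'a0/ha.
- exact: IH h.
Qed.

Lemma chain_cat n k a b c : chain n a b -> chain k b c -> chain (n + k) a c.
Proof.
elim: n a => [|n IH] a /=; first by move=> ab; apply: chain_weak.
by move=> [a' [? ? h]] hk; exists a'; split=> //; apply: IH.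
Qed.

Lemma chain_leq k n a b : (k <= n)%N -> chain n a b -> chain k a b.
Proof.
elim: n k a => [|n IH] [|k] a //=; first by move=> _; apply: (@chain_sub n.+1).
by move=> kn [a' [? ? h]]; exists a'; split=> //; apply: IH h.
Qed.

Lemma sub_top a : {subset a <= (idl_top : ideal R)}.
Proof. by move=> u _; apply: in_top. Qed.

Definition isum a b := zadd a b 1.

Lemma isumP a b u : u \in isum a b <-> exists2 v, v \in b & u - v \in a.
Proof.
split=> [/zaddP[v vb]|[v vb h]]; first by rewrite mul1r; exists v.
by apply/zaddP; exists v; rewrite ?mul1r.
Qed.

Lemma isum_subl a b : {subset a <= isum a b}. Proof. exact: zadd_sub. Qed.

Lemma isum_subr a b : {subset b <= isum a b}.
Proof. by move=> u ub; rewrite -[u]mul1r; apply: zadd_in. Qed.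

Lemma isum_le a b c : {subset a <= c} -> {subset b <= c} -> {subset isum a b <= c}.
Proof. by move=> ac bc; apply: zadd_le => // v /bc; rewrite mul1r. Qed.

(** Multiplication by [z] embeds [R/(F : z)] in [R/F], with image
    [(F + z R)/F]; it carries chains forward, and back in [chain_zadd_colon]. *)
Lemma chain_colon_zadd n F z B : chain n (colon F z) B -> chain n F (zadd F B z).
Proof.
move=> h; apply: (@chain_weak n (zadd F (colon F z) z) (zadd F B z)) => //; first exact: zadd_sub.
suff H a : chain n a B -> {subset colon F z <= a} -> chain n (zadd F a z) (zadd F B z).
  by apply: (H _ h).
elim: n a {h} => [|n IH] a /= h Fa.
  by apply: zadd_le; [apply: zadd_sub | move=> u /h; apply: zadd_in].
case: h => a' [aa' a'a h]; exists (zadd F a' z); split.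
- by apply: zadd_le; [apply: zadd_sub | move=> u /aa'; apply: zadd_in].
- move=> hz; apply: a'a => u /(zadd_in F z)/hz/zaddP[v va hv].
  apply: (idl_sub (v := v)) => //; apply: Fa; apply/colonP.
  by rewrite mulrBl ![_ * z]mulrC.
- by apply: IH => // u /Fa/aa'.
Qed.

Lemma chain_zadd_colon n F z V G : {subset G <= colon F z} ->
  chain n F (zadd F V z) -> chain n G (isum G V).
Proof.
move=> GF h; pose dn M := meet (colon M z) (isum G V).
apply: (@chain_weak n (dn F) (isum G V)) => //.
  by move=> u uG; apply/meetP; split; [apply: GF | apply: isum_subl].
suff H M : chain n M (zadd F V z) -> {subset F <= M} ->
  chain n (dn M) (isum G V) by apply: (H _ h).
elim: n M {h} => [|n IH] M /= h FM.
  by move=> u /meetP[].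
case: h => M' [MM' M'M h]; exists (dn M'); split.
- by move=> u /meetP[/colonP/MM' h1 h2]; apply/meetP; split=> //; apply/colonP.
- move=> hd; apply: M'M => u uM'.
  have /zaddP[v vV hv] := chain_sub h uM'.
  have /hd/meetP[/colonP vM _] : v \in dn M'.
    apply/meetP; split; last exact: isum_subr.
    apply/colonP; rewrite mulrC; apply: (idl_subr (u := u)) => //.
    by apply: MM'; apply: FM.
  by apply: (idl_sub (FM _ hv)); rewrite mulrC.
- by apply: IH => // u /FM/MM'.
Qed.

(** The modular law: a strict inclusion [a < a'] stays strict after intersecting
    with [b] or after adding [b]. *)
Lemma chain_split n a b c : {subset a <= b} -> {subset b <= c} -> chain n a c ->
  exists k l, [/\ (n <= k + l)%N, chain k a b & chain l b c].
Proof.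
move=> ab bc h.
suff [k [l [nkl hk hl]]] : exists k l,
    [/\ (n <= k + l)%N, chain k (meet a b) b & chain l (isum a b) c].
  exists k, l; split=> //.
    by apply: chain_weak hk => // u ua; apply/meetP; split=> //; apply: ab.
  by apply: chain_weak hl => //; apply: isum_subr.
elim: n a {ab} h => [|n IH] a /=.
  move=> ac; exists 0%N, 0%N; split=> //=; first by move=> u /meetP[].
  exact: isum_le.
move=> [a' [aa' a'a /IH[k [l [nkl hk hl]]]]].
have [h|h] := pselect ({subset meet a' b <= meet a b}).
  exists k, l.+1; split; first by rewrite addnS.
    apply: chain_weak hk => // u /meetP[ua ub]; apply/meetP; split=> //; exact: aa'.
  exists (isum a' b); split=> //.
    apply: isum_le; last exact: isum_subr.
    by move=> u /aa'; apply: isum_subl.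
  move=> h'; apply: a'a => u ua'.
  have /h'/isumP[v vb uv] := isum_subl b ua'.
  apply: idl_sub (uv) _; have /h/meetP[] // : v \in meet a' b.
  by apply/meetP; split=> //; apply: idl_subr (aa' _ uv) ua'.
exists k.+1, l; split=> //=; last first.
  apply: chain_weak hl => //; apply: isum_le; last exact: isum_subr.
  by move=> u /aa'; apply: isum_subl.
exists (meet a' b); split=> //.
by move=> u /meetP[/aa' ? ?]; apply/meetP.
Qed.

(** The exact sequence [0 -> R/(a : z) -> R/a -> R/(a + z) -> 0], as a lower bound
    for the length of [R/a]. *)
Lemma chain_superadd n k a z b c : chain n b idl_top -> chain k c idl_top ->
  {subset colon a z <= b} -> {subset iadd a z <= c} -> chain (n + k) a idl_top.
Proof.
move=> hn hk ab ac; apply: (@chain_cat n k a (iadd a z)).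
  by apply: chain_colon_zadd; apply: chain_weak hn.
exact: chain_weak hk.
Qed.

(** [ilen a b] is the length of [b/a] when it is finite, and the default [0]
    otherwise. *)
Definition len a b n := chain n a b /\ forall k, chain k a b -> (k <= n)%N.
Definition fin a b := exists n, forall k, chain k a b -> (k <= n)%N.
Definition ilen a b : nat := xget 0%N (len a b).

Lemma ilenP a b : {subset a <= b} -> fin a b -> len a b (ilen a b).
Proof.
move=> ab [n hn]; apply: xgetPex.
have h0 : exists k, `[< chain k a b >] by exists 0%N; apply/asboolP.
have h1 k : `[< chain k a b >] -> (k <= n)%N by move/asboolP/hn.
case: (ex_maxnP h0 h1) => k /asboolP hk hmax; exists k; split=> // j hj.
by apply: hmax; apply/asboolP.
Qed.

Lemma ilen_ge a b k : fin a b -> chain k a b -> (k <= ilen a b)%N.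
Proof. by move=> hf h; have [_ H] := ilenP (chain_sub h) hf; apply: H. Qed.

Lemma ilen_chain a b : {subset a <= b} -> fin a b -> chain (ilen a b) a b.
Proof. by move=> ab /(ilenP ab)[]. Qed.

Lemma fin_mono a b a' b' :
  (forall k, chain k a' b' -> chain k a b) -> fin a b -> fin a' b'.
Proof. by move=> h [n hn]; exists n => k /h/hn. Qed.

Lemma ilen_mono a b a' b' : {subset a' <= b'} ->
  (forall k, chain k a' b' -> chain k a b) -> fin a b -> (ilen a' b' <= ilen a b)%N.
Proof.
by move=> ab' h hf; apply: ilen_ge => //; apply/h/ilen_chain => //; apply: fin_mono hf.
Qed.

Lemma fin_sub a b a' b' : {subset a <= a'} -> {subset b' <= b} -> fin a b -> fin a' b'.
Proof. by move=> aa' bb'; apply: fin_mono => k; apply: chain_weak. Qed.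

Lemma fin_add a b c : {subset a <= b} -> {subset b <= c} ->
  fin a b -> fin b c -> fin a c.
Proof.
move=> ab bc [n hn] [k hk]; exists (n + k)%N => j.
by case/(chain_split ab bc) => i [l [jil /hn i_n /hk l_k]]; lia.
Qed.

Lemma ilen_add a b c : {subset a <= b} -> {subset b <= c} -> fin a c ->
  ilen a c = (ilen a b + ilen b c)%N.
Proof.
move=> ab bc hf.
have fab : fin a b by apply: fin_sub hf.
have fbc : fin b c by apply: fin_sub hf.
apply/eqP; rewrite eqn_leq; apply/andP; split.
  have [|k [l [hkl hk hl]]] := chain_split ab bc (ilen_chain _ hf).
    by move=> u /ab/bc.
  by apply: leq_trans hkl _; apply: leq_add; apply: ilen_ge.
by apply: ilen_ge => //; apply: chain_cat; apply: ilen_chain.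
Qed.

Lemma ilen_nil a b : {subset a <= b} -> {subset b <= a} -> ilen a b = 0%N.
Proof.
move=> ab ba; have h k : chain k a b -> (k <= 0)%N.
  by case: k => //= k [a' [aa' a'a /chain_sub a'b]]; case: a'a => u /a'b/ba.
by apply/eqP; rewrite -leqn0; apply: (h _ (ilen_chain ab _)); exists 0%N.
Qed.

End Chains.

Section QuotientChains.
Variables (R : comNzRingType) (J : ideal R).
Local Notation Q := (@Quotient.quot R^o (submodule_pred J)).
Local Open Scope quotient_scope.

Let piJ (u : R^o) : quot_module J := \pi_Q u.

Lemma quot_eq (u v : R) : (piJ u = piJ v) <-> (u - v \in J).
Proof.
have E : (u - v \in J) = (piJ u == piJ v) := Quotient.idealrBE J u v.
by rewrite E; split=> /eqP.
Qed.

Lemma quot_linear (r u v : R) : piJ (r * u + v) = r *: piJ u + piJ v.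
Proof.
by rewrite /piJ (raddfD \pi_Q); congr (_ + _); exact: (@pi_scale R R^o J r u).
Qed.

Lemma quot0 : piJ 0 = 0. Proof. exact: (raddf0 \pi_Q). Qed.

Lemma chain_seq n (a b : ideal R) : chain n a b -> exists N : nat -> ideal R,
  (forall i, {subset a <= N i}) /\
  forall i, (i < n)%N -> {subset N i <= N i.+1} /\ ~ {subset N i.+1 <= N i}.
Proof.
elim: n a => [|n IH] a /=; first by move=> _; exists (fun=> a); split=> [i u //|i]; rewrite ltn0.
move=> [a' [aa' a'a /IH[N [aN NS]]]].
exists (fun i => if i is j.+1 then if j is 0%N then a' else N j else a); split.
  by move=> [|[|i]] // u /aa' //; apply: aN.
move=> [|[|i]] //= iltn; last exact: NS.
have [h1 h2] := NS 0%N iltn.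
split; first exact: aN.
by move=> h; apply: h2 => u /h/aN.
Qed.

Lemma seq_chain n (N : nat -> ideal R) :
  (forall i, (i < n)%N -> {subset N i <= N i.+1} /\ ~ {subset N i.+1 <= N i}) ->
  chain n (N 0%N) idl_top.
Proof.
elim: n N => [|n IH] N h /=; first by move=> u _; apply: in_top.
have [h1 h2] := h 0%N (ltn0Sn _).
by exists (N 1%N); split=> //; apply: (IH (fun i => N i.+1)) => i; apply: (h i.+1).
Qed.

Lemma quot_chainP n : submodule_chain (quot_module J) n <-> chain n J idl_top.
Proof.
split=> [[N NS]|/chain_seq[N [JN NS]]].
  pose T i (u : R) : Prop := piJ u \in N i.
  have T0 i : T i 0 by rewrite /T quot0; apply: rpred0.
  have TS i (r u v : R) : T i u -> T i v -> T i (r * u + v).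
    by move=> hu hv; rewrite /T quot_linear; apply: rpredD => //; apply: rpredZ.
  pose N' i : ideal R := @mk_ideal R (T i) (T0 i) (TS i).
  have N'P i u : u \in N' i <-> T i u by apply: (@mk_idealP R (T i)).
  apply: (@chain_weak _ n (N' 0%N) idl_top) => //.
    move=> u uJ; apply/N'P; rewrite /T.
    have -> : piJ u = piJ 0 by apply/quot_eq; rewrite subr0.
    exact: T0.
  apply: seq_chain => i /NS[h1 h2]; split; first by move=> u /N'P/h1 h; apply/N'P.
  move=> h; apply: h2 => x xN; rewrite -[x]reprK.
  by apply/(N'P i (repr x))/h/N'P; rewrite /T /piJ reprK.
pose T i (x : quot_module J) := exists2 u : R, u \in N i & x = piJ u.
have TC i : submod_closed ((fun x => `[< T i x >]) : {pred quot_module J}).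
  split; first by apply/asboolP; exists 0; [apply: idl0 | rewrite quot0].
  move=> r x y /asboolP[u uN ->] /asboolP[v vN ->]; apply/asboolP.
  by exists (r * u + v); [apply: idlD => //; apply: idlMl | rewrite quot_linear].
pose N' i := MkSubmodule (TC i).
exists N' => i /NS[h1 h2]; split.
  by move=> x /asboolP[u /h1 uN ->]; apply/asboolP; exists u.
move=> h; apply: h2 => u uN.
have /h/asboolP[v vN /quot_eq uv] : piJ u \in N' i.+1 by apply/asboolP; exists u.
exact: idl_sub (JN i _ uv) vN.
Qed.

Variable K : realType.

Lemma quot_length_fin : fin J idl_top ->
  quot_length K J = ((ilen J idl_top)%:R)%:E.
Proof.
move=> hf; have [h1 h2] := ilenP (@sub_top R J) hf.
apply/eqP; rewrite eq_le; apply/andP; split.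
  apply: ub_ereal_sup => _ [n /quot_chainP/h2 hn <-].
  by rewrite lee_fin ler_nat.
by apply: ereal_sup_ubound; exists (ilen J idl_top) => //; apply/quot_chainP.
Qed.

Lemma quot_length_inf : ~ fin J idl_top -> quot_length K J = +oo%E.
Proof.
move=> hf; apply/eqyP => r _.
have [n hn] : exists n, (r <= n%:R)%R.
  by exists (Num.bound `|r|); apply/ltW/(le_lt_trans (ler_norm r)); exact: archi_boundP.
apply: (@le_trans _ _ (n%:R)%:E); first by rewrite lee_fin.
apply: ereal_sup_ubound; exists n => //; apply/quot_chainP.
apply: contrapT => nn; apply: hf; exists n => k hk; rewrite leqNgt.
by apply/negP => nk; apply: nn; apply: chain_leq (ltnW nk) hk.
Qed.

End QuotientChains.

(** * Powers of ideals and Hilbert functions *)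

Section Powers.
Variable R : comNzRingType.
Implicit Types (a b B F V : ideal R) (u v w z : R) (s l : seq R).

Fixpoint monomials s : nat -> seq R :=
  if s is z :: s' then
    fix pwz n := if n is n'.+1 then [seq z * g | g <- pwz n'] ++ monomials s' n else [:: 1]
  else fun n => if n is 0%N then [:: 1] else [::].

(** The power [(s) ^ n], through generators that allow recursion on [s] and
    commute with Frobenius. *)
Definition pw s n : ideal R := ideal_gen (monomials s n).

Lemma pw0 s : pw s 0 = idl_top.
Proof. by apply: idl_topP; apply: gen_in; case: s => [|z s] /=; rewrite mem_head. Qed.

Lemma gen_map_mul z l l' :
  ideal_gen ([seq z * g | g <- l] ++ l') = zadd (ideal_gen l') (ideal_gen l) z.
Proof.
apply: ideal_eq.
  apply: gen_le => u; rewrite mem_cat => /orP[/mapP[g gl ->]|ul'].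
    by apply: zadd_in; apply: gen_in.
  by apply: zadd_sub; apply: gen_in.
apply: zadd_le.
  by apply: gen_le => u ul'; apply: gen_in; rewrite mem_cat ul' orbT.
move=> g gl; rewrite mulrC; apply/colonP; move: g gl; apply: gen_le => g gl.
by apply/colonP; rewrite mulrC; apply: gen_in; rewrite mem_cat map_f.
Qed.

Lemma pwS z s n : pw (z :: s) n.+1 = zadd (pw s n.+1) (pw (z :: s) n) z.
Proof. exact: gen_map_mul. Qed.

Lemma pw_nil n : pw [::] n.+1 = idl_zero.
Proof. exact: gen_nil. Qed.

Lemma pw_mul s n w u : w \in s -> u \in pw s n -> w * u \in pw s n.+1.
Proof.
elim: s n u => [|z s IH] // n u; rewrite in_cons => /orP[/eqP->|ws].
  by rewrite pwS; apply: zadd_in.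
elim: n u => [|n IHn] u.
  by move=> _; rewrite pwS; apply: zadd_sub; apply: IH; rewrite // pw0 in_top.
rewrite pwS => /zaddP[v vn hv]; rewrite pwS; apply/zaddP; exists (w * v).
  exact: IHn.
by rewrite mulrCA -mulrBr; apply: IH.
Qed.

Lemma pw_gen_mul s n w u : w \in ideal_gen s -> u \in pw s n -> w * u \in pw s n.+1.
Proof.
move=> ws un; apply/colonP; move: w ws; apply: gen_le => w ws.
by apply/colonP; apply: pw_mul.
Qed.

Lemma pw_exp s n u : u \in ideal_gen s -> u ^+ n \in pw s n.
Proof.
move=> us; elim: n => [|n IH]; first by rewrite pw0; apply: in_top.
by rewrite exprS; apply: pw_gen_mul.
Qed.

Lemma pw1 s : pw s 1 = ideal_gen s.
Proof.
elim: s => [|z s IH]; first by rewrite pw_nil gen_nil.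
by rewrite pwS pw0 IH gen_cons.
Qed.

Lemma pw_cons_sub z s n : {subset pw s n <= pw (z :: s) n}.
Proof. by case: n => [|n]; rewrite ?pw0 // pwS; apply: zadd_sub. Qed.

Lemma pw_dec s n : {subset pw s n.+1 <= pw s n}.
Proof.
elim: s n => [|z s IH] n; first by rewrite pw_nil => u /in_zero->; apply: idl0.
elim: n => [|n IHn]; first by rewrite pw0; apply: sub_top.
rewrite [pw (z :: s) n.+1]pwS pwS; apply: zadd_le; first by move=> u /IH/zadd_sub.
by move=> u /IHn; apply: zadd_in.
Qed.

Lemma ideal_pow_mul B n w u : w \in B -> u \in ideal_pow B n -> w * u \in ideal_pow B n.+1.
Proof.
move=> wB un; rewrite mulrC; apply/colonP; move/spanP: un; apply => _ [h hB <-].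
apply/colonP/spanP => J; apply.
exists (fun i : 'I_n.+1 => if unlift ord0 i is Some j then h j else w).
  by move=> i; case: unliftP => [j _|_ //]; apply: hB.
rewrite big_ord_recl unlift_none mulrC; congr (_ * _).
by apply: eq_bigr => i _; rewrite liftK.
Qed.

Lemma ideal_pow0 B : ideal_pow B 0 = idl_top.
Proof.
apply: idl_topP; apply/spanP => J; apply.
by exists (fun=> 0) => [[]//|]; rewrite big_ord0.
Qed.

Lemma ideal_powE s n : ideal_pow (ideal_gen s) n = pw s n.
Proof.
apply: ideal_eq.
  suff H (h : 'I_n -> R) : (forall i, h i \in ideal_gen s) ->
      (\prod_(i < n) h i : R) \in pw s n.
    by move=> u /spanP; apply=> _ [h hs <-]; apply: (H h hs).
  elim: n h => [|n IH] h hs; first by rewrite pw0; apply: in_top.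
  by rewrite big_ord_recl; apply: pw_gen_mul => //; apply: IH => i; apply: hs.
have : {subset s <= ideal_gen s} by apply: gen_in.
move: (ideal_gen s) => B; elim: s n => [|z s IH] n sB.
  case: n => [|n]; first by rewrite ideal_pow0; apply: sub_top.
  by rewrite pw_nil => u /in_zero->; apply: idl0.
elim: n => [|n IHn]; first by rewrite ideal_pow0; apply: sub_top.
rewrite pwS; apply: zadd_le.
  by apply: IH => u us; apply: sB; rewrite in_cons us orbT.
by move=> u /IHn; apply: ideal_pow_mul; apply: sB; rewrite mem_head.
Qed.

Lemma pw_le s n k : (n <= k)%N -> {subset pw s k <= pw s n}.
Proof.
move=> nk; rewrite -(subnK nk); elim: (k - n)%N => [|i IH] u //.
by rewrite addSn => /pw_dec/IH.
Qed.

(** The pigeonhole principle on exponents, one variable [z] at a time: the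
    factors [z] are collected in [z ^+ r] until they form a [q]-th power. *)
Lemma pw_frob_sub q s n N : (0 < q)%N -> (q * (n + size s) <= N)%N ->
  {subset pw s N <= pw [seq x ^+ q | x <- s] n}.
Proof.
move=> q0; elim: s n N => [|z s IHs] n N.
  case: n => [|n]; first by rewrite pw0 => _; apply: sub_top.
  case: N => [|N]; first by rewrite /= addn0 leqn0 muln_eq0 -leqn0 leqNgt q0.
  by rewrite pw_nil => _ u /in_zero->; apply: idl0.
move=> hN; have {hN} : (q * (n + (size s).+1) <= N + 0)%N by rewrite addn0.
suff H r u : (r <= q)%N -> (q * (n + (size s).+1) <= N + r)%N ->
    u \in pw (z :: s) N -> z ^+ r * u \in pw [seq x ^+ q | x <- z :: s] n.
  by move=> hN u uN; rewrite -[u]mul1r -(expr0 z); apply: H.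
elim: n N r u => [|n IHn] N r u; first by rewrite pw0 => _ _ _; apply: in_top.
elim: N r u => [|N IHN] r u rq.
  move=> h; exfalso; move: h; rewrite add0n => h.
  by move: (leq_trans h rq); rewrite -[X in (_ <= X)%N]muln1 leq_pmul2l //; lia.
have [->|r_neq] := eqVneq r q.
  move=> h uN; apply: pw_mul; first by rewrite /= mem_head.
  rewrite -[u]mul1r -(expr0 z); apply: (IHn N.+1) => //.
  by move: h; rewrite addSn mulnS; move: (q * _)%N => Y; lia.
have {}rq : (r < q)%N by rewrite ltn_neqAle r_neq.
move=> h; rewrite pwS => /zaddP[v vN hv].
have -> : z ^+ r * u = z ^+ r.+1 * v + z ^+ r * (u - z * v) by rewrite exprSr; ring.
apply: idlD; first by apply: IHN => //; rewrite [(N + _)%N]addnS -addSn.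
apply: idlMl; apply: pw_cons_sub; apply: (IHs n.+1 N.+1) => //.
by move: h; rewrite addnS mulnS; move: (q * _)%N => Y; lia.
Qed.

End Powers.

Section Hilbert.
Variable R : comNzRingType.
Implicit Types (a b B F V : ideal R) (u v w z : R) (s l : seq R).

Lemma chain_zaddP k F z V :
  chain k F (zadd F V z) <-> chain k (colon F z) (isum (colon F z) V).
Proof.
split; first exact: chain_zadd_colon.
move/chain_colon_zadd; apply: chain_weak => //; apply: zadd_le; first exact: zadd_sub.
move=> u /isumP[v vV /colonP uv].
by apply/zaddP; exists v; rewrite // -mulrBr mulrC.
Qed.

Lemma ilen_zadd F z V : ilen F (zadd F V z) = ilen (colon F z) (isum (colon F z) V).
Proof.
have E k := propext (chain_zaddP k F z V).
rewrite /ilen; congr xget; apply/funext => n; rewrite /len E.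
by congr (_ /\ _); apply: eq_forall => k; rewrite E.
Qed.

(** The numerical form of the ratio bound: in each term, the degree splits
    between the exponent [j] of the first variable and the rest. *)
Lemma weighted_sum_le (f f' : nat -> nat) n r :
  (forall j, (j <= n)%N -> ((n - j).+1 * f' j <= (n - j + r) * f j)%N) ->
  (forall j, (j <= n)%N -> (f' j.+1 <= f j)%N) ->
  (n.+1 * (\sum_(j < n.+2) f' j) <= (n + r.+1) * \sum_(j < n.+1) f j)%N.
Proof.
move=> h1 h2.
have -> : (n.+1 * (\sum_(j < n.+2) f' j) =
    \sum_(j < n.+1) (n - j).+1 * f' j + \sum_(j < n.+1) j.+1 * f' j.+1)%N.
  have -> : (\sum_(j < n.+1) (n - j).+1 * f' j = \sum_(j < n.+2) (n.+1 - j) * f' j)%N.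
    rewrite [RHS]big_ord_recr /= subnn mul0n addn0; apply: eq_bigr => j _.
    by rewrite subSn // -ltnS.
  have -> : (\sum_(j < n.+1) j.+1 * f' j.+1 = \sum_(j < n.+2) j * f' j)%N.
    by rewrite [RHS]big_ord_recl /= mul0n add0n.
  rewrite -big_split big_distrr /=; apply: eq_bigr => j _.
  by rewrite -mulnDl subnK // -ltnS.
have -> : ((n + r.+1) * (\sum_(j < n.+1) f j) =
    \sum_(j < n.+1) (n - j + r) * f j + \sum_(j < n.+1) j.+1 * f j)%N.
  rewrite -big_split big_distrr /=; apply: eq_bigr => j _.
  by rewrite -mulnDl; congr (_ * _)%N; have := ltn_ord j; lia.
by apply: leq_add; apply: leq_sum => j _;
  [apply: h1 | rewrite leq_mul2l h2 ?orbT]; rewrite // -ltnS.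
Qed.

(** Hilbert functions of quotients of a polynomial ring in [size s] variables
    grow at most as fast, from one degree to the next, as that of the polynomial
    ring. Here [L n] plays the role of the relations in degree [n]: the quotient
    in degree [n] is [(pw s n + L n) / L n].

    Filtering by powers of the first variable [z] expresses the Hilbert function
    as a sum over [j] of Hilbert functions in one variable less, for the
    relations [L' n j] among the leading coefficients of [z ^ j]. *)
Lemma hilbert_ratio s (L : nat -> ideal R) :
  (forall n w u, w \in s -> u \in L n -> w * u \in L n.+1) ->
  (forall n, fin (L n) (isum (L n) (pw s n))) ->
  forall n, (n.+1 * ilen (L n.+1) (isum (L n.+1) (pw s n.+1)) <=
             (n + size s) * ilen (L n) (isum (L n) (pw s n)))%N.
Proof.
elim: s L => [|z s IH] L hL hfin n.
  rewrite ilen_nil ?muln0 //; first exact: isum_subl.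
  apply: isum_le => //; rewrite pw_nil => u /in_zero->; exact: idl0.
(* The filtration of [(pw (z :: s) n + L n) / L n] by powers of [z], which ends
   with [F n n.+1 = L n]. *)
pose F n j := if (j <= n)%N then zadd (L n) (pw (z :: s) (n - j)) (z ^+ j) else L n.
have LF k j : {subset L k <= F k j}.
  by rewrite /F; case: ifP => _ u uL //; apply: zadd_sub.
have F0 k : F k 0%N = isum (L k) (pw (z :: s) k) by rewrite /F /= subn0.
have FS k : F k k.+1 = L k by rewrite /F ltnn.
have FE k j : (j <= k)%N -> F k j = zadd (F k j.+1) (pw s (k - j)) (z ^+ j).
  rewrite /F => jk; rewrite jk; case: ltngtP jk => // [jk _|-> _]; last first.
    by rewrite subnn !pw0.
  have e : (k - j = (k - j.+1).+1)%N by lia.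
  rewrite e pwS; apply: ideal_eq; apply: zadd_le.
  - by move=> u uL; do 2!apply: zadd_sub.
  - move=> u /zaddP[v vV hv]; apply/zaddP; exists (u - z * v) => //.
    have -> : z ^+ j * u - z ^+ j * (u - z * v) = z ^+ j.+1 * v by rewrite exprSr; ring.
    exact: zadd_in.
  - apply: zadd_le; first exact: zadd_sub.
    by move=> u uV; rewrite exprSr -mulrA; apply: zadd_in; apply: zadd_in.
  - by move=> u uV; apply: zadd_in; apply: zadd_sub.
have Fdec k j : (j <= k)%N -> {subset F k j.+1 <= F k j}.
  by move=> jk; rewrite (FE k j jk); apply: zadd_sub.
have Fw k j w u : w \in z :: s -> u \in F k j -> w * u \in F k.+1 j.
  move=> ws; rewrite {1}/F; case: ifP => jk; last by move=> /(hL _ _ _ ws); apply: LF.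
  move=> /zaddP[v vV hv]; rewrite /F (leqW jk) subSn //; apply/zaddP.
  exists (w * v); first exact: pw_mul.
  by rewrite mulrCA -mulrBr; apply: hL.
have Fz k j u : u \in F k j -> z * u \in F k.+1 j.+1.
  have zs : z \in z :: s by rewrite mem_head.
  rewrite {1}/F; case: ifP => jk; last by move=> /(hL _ _ _ zs); apply: LF.
  move=> /zaddP[v vV hv]; rewrite /F ltnS jk subSS; apply/zaddP.
  exists v => //; rewrite exprS -mulrA -mulrBr; exact: hL.
have FF0 k j : (j <= k.+1)%N -> {subset F k j <= F k 0%N}.
  by elim: j => [|j IHj] jk // u uF; apply: IHj; [apply: ltnW | apply: Fdec].
have Ffin k j : (j <= k)%N -> fin (F k j.+1) (F k j).
  move=> jk; apply: fin_sub (hfin k); first exact: LF.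
  by rewrite -F0; apply: FF0; apply: leqW.
pose L' k j := colon (F k j.+1) (z ^+ j).
pose f k j := ilen (L' k j) (isum (L' k j) (pw s (k - j))).
have fE k j : (j <= k)%N -> ilen (F k j.+1) (F k j) = f k j.
  by move=> jk; rewrite [X in ilen _ X]FE // ilen_zadd.
have f_fin k j : (j <= k)%N -> fin (L' k j) (isum (L' k j) (pw s (k - j))).
  move=> jk; apply: fin_mono (Ffin k j jk) => i.
  by rewrite (FE k j jk) => hi; apply/chain_zaddP.
have phiE k : ilen (L k) (isum (L k) (pw (z :: s) k)) = (\sum_(j < k.+1) f k j)%N.
  rewrite -F0 -FS.
  suff H i : (i <= k.+1)%N -> ilen (F k i) (F k 0%N) = (\sum_(j < i) f k j)%N.
    exact: H.
  elim: i => [|i IHi] ik; first by rewrite big_ord0 ilen_nil.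
  rewrite big_ord_recr /= -IHi; last exact: ltnW.
  have ik' : (i <= k)%N := ik.
  have -> : ilen (F k i.+1) (F k 0%N) =
      (ilen (F k i.+1) (F k i) + ilen (F k i) (F k 0%N))%N.
    apply: ilen_add; [exact: Fdec | by apply: FF0; apply: ltnW |].
    by apply: fin_sub (hfin k); [apply: LF | rewrite F0].
  by rewrite (fE k i ik') addnC.
rewrite !phiE /=; apply: weighted_sum_le => j jn.
  have H := IH (fun i => L' (i + j)%N j) _ _ (n - j)%N.
  rewrite /f; move: H; rewrite addSn subnK // subSn //; apply.
    move=> i w u ws /colonP h; apply/colonP; rewrite addSn -mulrA; apply: Fw => //.
    by rewrite in_cons ws orbT.
  by move=> i; have := f_fin (i + j)%N j (leq_addl _ _); rewrite addnK.
have LL' : {subset L' n j <= L' n.+1 j.+1}.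
  by move=> u /colonP h; apply/colonP; rewrite exprS mulrCA; apply: Fz.
rewrite /f subSS; apply: ilen_mono; [exact: isum_subl | | exact: f_fin].
move=> k; apply: chain_zadd_colon => u /LL' h; apply/colonP; by rewrite mulr1.
Qed.

Section HilbertSamuel.
Variable s : seq R.
Hypothesis fin_s : fin (ideal_gen s) idl_top.

(** An ideal generated over [a] by finitely many elements that [(s)] kills modulo
    [a] is filtered by quotients of [R/(s)]. *)
Lemma fin_killed l a : (forall w g, w \in s -> g \in l -> w * g \in a) ->
  fin a (adds a l).
Proof.
elim: l a => [|x l IH] a h /=.
  by exists 0%N => -[|k] //= [a' [_ h1 /chain_sub h2]].
apply: (@fin_add _ a (iadd a x)); [exact: iadd_sub | exact: adds_sub | |].
  apply: fin_mono fin_s => k /chain_zaddP; apply: chain_weak; last exact: sub_top.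
  by apply: gen_le => w ws; apply/colonP; apply: h; rewrite // mem_head.
by apply: IH => w g ws gl; apply: iadd_sub; apply: h; rewrite // in_cons gl orbT.
Qed.

Lemma isum_pw n : isum (pw s n.+1) (pw s n) = pw s n.
Proof.
apply: ideal_eq; last exact: isum_subr.
by apply: isum_le => //; apply: pw_dec.
Qed.

Lemma fin_layer n : fin (pw s n.+1) (pw s n).
Proof.
apply: fin_sub (@fin_killed (monomials s n) (pw s n.+1) _) => //.
  by apply: gen_le; apply: adds_in.
by move=> w g ws gn; apply: pw_mul => //; apply: gen_in.
Qed.

Lemma fin_pw n : fin (pw s n) idl_top.
Proof.
elim: n => [|n IH]; first by rewrite pw0; exists 0%N => -[|k] //= [a' [_ h1 /chain_sub h2]].
apply: (fin_add _ _ (fin_layer n) IH); [exact: pw_dec | exact: sub_top].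
Qed.

(** The Hilbert-Samuel function of [(s)]. *)
Definition hsf n := ilen (pw s n) idl_top.

Let layer n := ilen (pw s n.+1) (pw s n).

Lemma hsfS n : hsf n.+1 = (layer n + hsf n)%N.
Proof. by apply: ilen_add; [exact: pw_dec | exact: sub_top | exact: fin_pw]. Qed.

Lemma layer_ratio n : (n.+1 * layer n.+1 <= (n + size s) * layer n)%N.
Proof.
have := @hilbert_ratio s (fun n => pw s n.+1) _ _ n.
rewrite !isum_pw; apply; first by move=> k w u; apply: pw_mul.
by move=> k; rewrite isum_pw; apply: fin_layer.
Qed.

Lemma layer_hsf n : (n * layer n <= size s * hsf n)%N.
Proof.
elim: n => [|n IH]; first by rewrite mul0n.
apply: leq_trans (layer_ratio n) _; rewrite hsfS mulnDl mulnDr.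
by rewrite addnC leq_add2l.
Qed.

(** So [hsf n / 'C(n + d - 1, d)] does not increase, for [d = size s]. *)
Lemma hsf_ratio n : (n * hsf n.+1 <= (n + size s) * hsf n)%N.
Proof. by rewrite hsfS mulnDr mulnDl addnC leq_add2l layer_hsf. Qed.

End HilbertSamuel.
End Hilbert.

(** * Tight closure of parameter ideals *)

Section TightClosure.
Variables (R : comNzRingType) (p : nat).
Hypothesis hp : p \in [pchar R].
Implicit Types (I J : ideal R) (c u v w z : R) (s t r x y : seq R).

Local Notation tc := (tight_closure hp).

Definition pows x (a : seq nat) := [seq i.1 ^+ i.2 | i <- zip x a].
Definition powq (q : nat) x := [seq i ^+ q | i <- x].

Lemma pows_nseq x q : pows x (nseq (size x) q) = powq q x.
Proof. by elim: x => [|i x IH] //=; rewrite -IH. Qed.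

Lemma powq1 x : powq 1 x = x.
Proof. by rewrite /powq -[RHS]map_id; apply: eq_map => i; rewrite expr1. Qed.

Lemma powq_cat q x y : powq q (x ++ y) = powq q x ++ powq q y.
Proof. exact: map_cat. Qed.

(** In characteristic [p] the map [u |-> u ^ (p ^ e)] is additive, so powers of
    generators generate the Frobenius power. *)
Lemma frobenius_gen s e : frobenius_pow (ideal_gen s) (p ^ e) = ideal_gen (powq (p ^ e) s).
Proof.
have p0 := prime_gt0 (pcharf_prime hp).
apply: ideal_eq => u.
  move/spanP; apply=> _ [v vs <-].
  move: vs; elim: s v => [|z s IH] v.
    rewrite gen_nil => /in_zero->; rewrite expr0n expn_eq0 eqn0Ngt p0; exact: idl0.
  rewrite gen_cons => /iaddP[a /IH ha].
  rewrite [powq _ (z :: s)]/= gen_cons; apply/iaddP.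
  exists (a ^+ (p ^ e)); rewrite -exprMn.
  have -> // : v ^+ (p ^ e) - (a * z) ^+ (p ^ e) = (v - a * z) ^+ (p ^ e).
  rewrite -[X in X ^+ _ - _](subrK (a * z)) exprDn_pchar ?addrK //.
  by rewrite pnatX pnatE ?hp ?(pcharf_prime hp).
apply: gen_le => _ /mapP[v vs ->]; apply/spanP => J; apply.
by exists v => //; apply: gen_in.
Qed.

Lemma tcP I u : u \in tc I <-> exists2 c, Rcirc c & exists e0, forall e, (e0 <= e)%N ->
  c * u ^+ (p ^ e) \in frobenius_pow I (p ^ e).
Proof. by split=> /asboolP. Qed.

Lemma tc_genP s u : u \in tc (ideal_gen s) <->
  exists2 c, Rcirc c & exists e0, forall e, (e0 <= e)%N ->
  c * u ^+ (p ^ e) \in ideal_gen (powq (p ^ e) s).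
Proof.
rewrite tcP; split=> -[c hc [e0 he]]; exists c => //; exists e0 => e /he;
  by rewrite frobenius_gen.
Qed.

Lemma tc_mono I J : {subset I <= J} -> {subset tc I <= tc J}.
Proof.
move=> IJ u /tcP[c hc [e0 he]]; apply/tcP; exists c => //; exists e0 => e /he.
move/spanP; apply=> _ [v vI <-]; apply/spanP => B; apply.
by exists v => //; apply: IJ.
Qed.

Lemma tc_sub I : {subset I <= tc I}.
Proof.
move=> u uI; apply/tcP; exists 1; first exact: Rcirc1.
by exists 0%N => e _; rewrite mul1r; apply/spanP => B; apply; exists u.
Qed.

Lemma tc_iadd I J z : {subset I <= J} -> z \in J -> {subset iadd (tc I) z <= tc J}.
Proof. by move=> IJ zJ; apply: iadd_le; [apply: tc_mono | apply: tc_sub]. Qed.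

(** Uniform colon capturing: one [c] serves all powers, so that it can serve in the
    definition of tight closure. *)
Definition capture y z : Prop := exists2 c, Rcirc c & forall q k u,
  u * z ^+ k \in ideal_gen (powq q y) -> c * u \in ideal_gen (powq q y).

Lemma gen_rcons s z : ideal_gen (rcons s z) = iadd (ideal_gen s) z.
Proof. by rewrite -cats1 gen_cat. Qed.

(** The [q]-th power of the hypothesis reads
    [(c' u^q - r z^q) z^(n q)] in [(y^q)], and colon capturing removes [z^(n q)]. *)
Lemma capture_colon y z n u : capture y z ->
  u * z ^+ n \in tc (ideal_gen (rcons y (z ^+ n.+1))) ->
  u \in tc (ideal_gen (rcons y z)).
Proof.
move=> [c cR hc] /tc_genP[c' c'R [e0 he]]; apply/tc_genP.
exists (c * c'); first exact: RcircM.
exists e0 => e /he; rewrite /powq !map_rcons !gen_rcons => /iaddP[r hr].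
apply/iaddP; exists (c * r).
have -> : c * c' * u ^+ (p ^ e) - c * r * z ^+ (p ^ e) =
  c * (c' * u ^+ (p ^ e) - r * z ^+ (p ^ e)) by ring.
apply: (hc (p ^ e)%N (n * p ^ e)%N).
have -> // : (c' * u ^+ (p ^ e) - r * z ^+ (p ^ e)) * z ^+ (n * p ^ e) =
  c' * (u * z ^+ n) ^+ (p ^ e) - r * (z ^+ n.+1) ^+ (p ^ e).
by rewrite exprMn -!exprM mulSn exprD; ring.
Qed.

(** Induction on [q]: multiplication by [z ^ q] separates the quotients for
    [(y, z)^*] and [(y, z ^ q)^*]. *)
Lemma chain_tc_power y z n q : capture y z -> chain n (tc (ideal_gen (rcons y z))) idl_top ->
  chain (q * n) (tc (ideal_gen (rcons y (z ^+ q)))) idl_top.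
Proof.
move=> hc hn; elim: q => [|q IH]; first exact: sub_top.
rewrite mulSn; apply: chain_superadd hn IH _ _.
  by move=> u /colonP; apply: capture_colon.
apply: tc_iadd; rewrite !gen_rcons; last exact: iadd_in.
apply: iadd_le; first exact: iadd_sub.
by rewrite exprS; apply: idlMl; apply: iadd_in.
Qed.

(** [c]-regularity of all powers of [y, z], whatever part of the sequence [x] they
    form, and whatever the order. *)
Definition captures x : Prop := forall y z r, perm_eq (y ++ z :: r) x ->
  exists2 c, Rcirc c & forall a k u, size a = size y ->
  u * z ^+ k \in ideal_gen (pows y a) -> c * u \in ideal_gen (pows y a).

Lemma powq_pows q x a : powq q (pows x a) = pows x [seq (i * q)%N | i <- a].
Proof.
by elim: x a => [|i x IH] [|k a] //=; congr (_ :: _); [rewrite exprM | apply: IH].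
Qed.

Lemma captures_capture x y z r a : captures x -> perm_eq (y ++ z :: r) x ->
  size a = size y -> capture (pows y a) z.
Proof.
move=> hx /hx[c cR hc] sa; exists c => // q k u; rewrite powq_pows.
by apply: hc; rewrite size_map.
Qed.

Lemma pows_cat x y a b : size a = size x -> pows (x ++ y) (a ++ b) = pows x a ++ pows y b.
Proof. by move=> sa; rewrite /pows zip_cat // map_cat. Qed.

(** The parameters [y] have already been raised to the power [q]; those of [s]
    follow one by one. *)
Lemma chain_tc_powers x n q y s : captures x -> perm_eq (y ++ s) x ->
  chain n (tc (ideal_gen (powq q y ++ s))) idl_top ->
  chain (q ^ size s * n) (tc (ideal_gen (powq q y ++ powq q s))) idl_top.
Proof.
move=> hx; elim: s y n => [|z s IH] y n hperm /=; first by rewrite mul1n.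
move=> hn; have E w t : ideal_gen (powq q y ++ w :: t) = ideal_gen (rcons (powq q y ++ t) w).
  by apply: gen_eqmem => u; rewrite mem_rcons !(mem_cat, in_cons) orbCA.
have hcap : capture (powq q y ++ s) z.
  have -> : powq q y ++ s = pows (y ++ s) (nseq (size y) q ++ nseq (size s) 1%N).
    by rewrite pows_cat ?size_nseq // !pows_nseq powq1.
  apply: (captures_capture (x := x) (r := [::])) => //; last by rewrite !size_cat !size_nseq.
  by apply: perm_trans hperm; apply/permP => P; rewrite !count_cat /=; lia.
rewrite expnSr -mulnA -[powq q y ++ _]cat_rcons.
have -> : rcons (powq q y) (z ^+ q) = powq q (rcons y z) by rewrite /powq map_rcons.
apply: IH; first by rewrite cat_rcons.
rewrite /powq map_rcons cat_rcons E; apply: chain_tc_power => //.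
by rewrite -E.
Qed.

Definition mixed t s n : ideal R := isum (ideal_gen t) (pw s n).

Lemma mixed_gen t s n : mixed t s n = ideal_gen (t ++ monomials s n).
Proof.
rewrite gen_cat; apply: ideal_eq.
  apply: isum_le; first exact: adds_sub.
  by apply: gen_le; apply: adds_in.
apply: adds_le; first exact: isum_subl.
by move=> u us; apply: isum_subr; apply: gen_in.
Qed.

Lemma mixed0 t s : mixed t s 0 = idl_top.
Proof. by apply: idl_topP; apply: isum_subr; rewrite pw0; apply: in_top. Qed.

Lemma mixed_nil t n : mixed t [::] n.+1 = ideal_gen t.
Proof.
apply: ideal_eq; last exact: isum_subl.
by apply: isum_le => //; rewrite pw_nil; apply: sub0i.
Qed.

Lemma mixedS t z s n : mixed t (z :: s) n.+1 = zadd (mixed t s n.+1) (mixed t (z :: s) n) z.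
Proof.
apply: ideal_eq.
  apply: isum_le; first by move=> u ut; apply: zadd_sub; apply: isum_subl.
  rewrite pwS; apply: zadd_le; first by move=> u us; apply: zadd_sub; apply: isum_subr.
  by move=> u us; apply: zadd_in; apply: isum_subr.
apply: zadd_le.
  apply: isum_le; first exact: isum_subl.
  by move=> u us; apply: isum_subr; apply: pw_cons_sub.
move=> u /isumP[v vs hv]; rewrite -[u](subrK v) mulrDr; apply: idlD.
  by apply: idlMl; apply: isum_subl.
by apply: isum_subr; apply: pw_mul; rewrite // mem_head.
Qed.

Lemma mixed_cons t z s n : mixed (z :: t) s n = iadd (mixed t s n) z.
Proof.
rewrite /mixed gen_cons; apply: ideal_eq.
  apply: isum_le; last by move=> u us; apply: iadd_sub; apply: isum_subr.
  by apply: iaddS; apply: isum_subl.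
apply: iadd_le; last by apply: isum_subl; apply: iadd_in.
apply: isum_le; last exact: isum_subr.
by move=> u ut; apply: isum_subl; apply: iadd_sub.
Qed.

Lemma mixed_dec t z s n : {subset mixed t s n.+1 <= mixed t (z :: s) n}.
Proof.
apply: isum_le; first exact: isum_subl.
by move=> u /pw_dec us; apply: isum_subr; apply: pw_cons_sub.
Qed.

Lemma mixedS_sub t z s n : {subset mixed t (z :: s) n.+1 <= iadd (mixed t s n.+1) z}.
Proof.
rewrite mixedS; apply: zadd_le; first exact: iadd_sub.
by move=> u _; apply: idlMr; apply: iadd_in.
Qed.

Lemma monomials_powq q s n : powq q (monomials s n) = monomials (powq q s) n.
Proof.
elim: s n => [|z s IH] n; first by case: n => [|n] //=; rewrite /powq /= expr1n.
elim: n => [|n IHn]; first by rewrite /powq /= expr1n.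
rewrite -[monomials (z :: s) n.+1]/([seq z * g | g <- monomials (z :: s) n] ++ monomials s n.+1).
rewrite powq_cat IH -[RHS]/([seq z ^+ q * g | g <- monomials (powq q (z :: s)) n] ++ _).
congr (_ ++ _); rewrite -IHn /powq -!map_comp; apply: eq_map => g /=.
exact: exprMn.
Qed.

Lemma powq_mixed q t s n :
  ideal_gen (powq q (t ++ monomials s n)) = mixed (powq q t) (powq q s) n.
Proof. by rewrite powq_cat monomials_powq -mixed_gen. Qed.

Lemma tc_mixedP t s n u : u \in tc (mixed t s n) <->
  exists2 c, Rcirc c & exists e0, forall e, (e0 <= e)%N ->
  c * u ^+ (p ^ e) \in mixed (powq (p ^ e) t) (powq (p ^ e) s) n.
Proof.
rewrite mixed_gen tc_genP; split=> -[c hc [e0 he]]; exists c => //; exists e0 => e /he;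
  by rewrite powq_mixed.
Qed.

(** Colon capturing for [(t) + (s) ^ n]. With [s = w :: s'], an element [u] with
    [u z] in the ideal is first controlled modulo [w]; its coefficient of [w] is
    then controlled in degree [n - 1]. *)
Lemma mixed_capture x s n t z r : captures x -> perm_eq (t ++ z :: s ++ r) x ->
  exists2 c, Rcirc c & forall q u,
    u * z ^+ q \in mixed (powq q t) (powq q s) n ->
    c * u \in mixed (powq q t) (powq q s) n.
Proof.
move=> hx; elim: s n t z r => [|w s IHs] n t z r hperm.
  case: n => [|n].
    by exists 1 => [|q u _]; [apply: Rcirc1 | rewrite mixed0; apply: in_top].
  have [c cR hc] := hx _ _ _ hperm; exists c => // q u.
  by rewrite /= mixed_nil -pows_nseq; apply: hc; rewrite size_nseq.
elim: n => [|n [c3 c3R h3]].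
  by exists 1 => [|q u _]; [apply: Rcirc1 | rewrite mixed0; apply: in_top].
have [|c1 c1R h1] := IHs n.+1 (w :: t) z r.
  by apply: perm_trans hperm; apply/permP => P; rewrite /= !count_cat /= !count_cat /=; lia.
have [|c2 c2R h2] := IHs n.+1 t w (z :: r).
  by apply: perm_trans hperm; apply/permP => P; rewrite /= !count_cat /= !count_cat /=; lia.
exists (c3 * c2 * c1); first by do 2!apply: RcircM => //.
move=> q u; rewrite /=; set T := powq q t; set S := powq q s; set W := w ^+ q; set Z := z ^+ q.
move=> hu.
have /iaddP[v hv] : c1 * u \in iadd (mixed T S n.+1) W.
  by rewrite -mixed_cons; apply: h1; rewrite /= mixed_cons; apply: mixedS_sub.
have : W * (v * Z) \in mixed T (W :: S) n.+1.
  have -> : W * (v * Z) = c1 * (u * Z) - Z * (c1 * u - v * W) by ring.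
  apply: idlB; first exact: idlMl.
  by apply: idlMl; rewrite mixedS; apply: zadd_sub.
rewrite mixedS => /zaddP[b bn hb].
have hc2 : c2 * (v * Z - b) \in mixed T S n.+1.
  by apply: h2; rewrite -/W mulrC mulrBr.
have hc3 : c3 * (c2 * v) \in mixed T (W :: S) n.
  apply: h3; rewrite -/Z.
  have -> : c2 * v * Z = c2 * (v * Z - b) + c2 * b by ring.
  by apply: idlD; [apply: mixed_dec | apply: idlMl].
apply/zaddP; exists (c3 * (c2 * v)) => //.
have -> : c3 * c2 * c1 * u - W * (c3 * (c2 * v)) = c3 * c2 * (c1 * u - v * W) by ring.
exact: idlMl.
Qed.

Lemma mixed_colon x t z s n u : captures x -> perm_eq (t ++ z :: s) x ->
  u * z \in tc (mixed t (z :: s) n.+1) -> u \in tc (mixed t (z :: s) n).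
Proof.
move=> hx hperm; have [|c cR hc] := @mixed_capture x s n.+1 t z [::] hx.
  by rewrite cats0.
move=> /tc_mixedP[c' c'R [e0 he]]; apply/tc_mixedP.
exists (c * c'); first exact: RcircM.
exists e0 => e /he; rewrite /= mixedS => /zaddP[b bn hb].
have -> : c * c' * u ^+ (p ^ e) = c * (c' * u ^+ (p ^ e) - b) + c * b by ring.
apply: idlD; last exact: idlMl.
apply: mixed_dec; apply: (hc (p ^ e)%N).
have -> // : (c' * u ^+ (p ^ e) - b) * z ^+ (p ^ e) =
  c' * (u * z) ^+ (p ^ e) - z ^+ (p ^ e) * b by rewrite exprMn; ring.
Qed.

(** Pascal's rule: multiplication by [z] on the quotient by
    [((t) + (z, s) ^ n.+2)^*] separates the quotients for [(t) + (z, s) ^ n.+1]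
    and [(t, z) + (s) ^ n.+2]. *)
Lemma chain_tc_mixed x s n t k : captures x -> perm_eq (t ++ s) x ->
  chain k (tc (ideal_gen (t ++ s))) idl_top ->
  chain ('C(n + size s, size s) * k) (tc (mixed t s n.+1)) idl_top.
Proof.
move=> hx; elim: s n t => [|z s IHs] n t hperm hk.
  by rewrite bin0 mul1n mixed_nil -[t]cats0.
elim: n => [|n IHn].
  rewrite add0n binn mul1n; move: hk; rewrite /mixed pw1 gen_cat.
  apply: chain_weak => //; apply: tc_mono; apply: isum_le; first exact: adds_sub.
  by apply: gen_le; apply: adds_in.
rewrite addSn /= binS mulnDl.
have -> : 'C(n + (size s).+1, size s) = 'C(n.+1 + size s, size s) by rewrite addSnnS.
apply: chain_superadd (IHn) (IHs n.+1 (z :: t) _ _) _ _.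
- by apply: perm_trans hperm; apply/permP => P; rewrite /= !count_cat /=; lia.
- move: hk; rewrite (@gen_eqmem _ (t ++ z :: s) ((z :: t) ++ s)) // => u.
  by rewrite /= !(mem_cat, in_cons) orbCA.
- by move=> u /colonP; apply: mixed_colon hx hperm.
- rewrite mixed_cons; apply: tc_iadd; last exact: iadd_in.
  exact: mixedS_sub.
Qed.

End TightClosure.

(** * Asymptotics of the Hilbert-Samuel function *)

Import numFieldNormedType.Exports.

Section Asymptotics.
Variables (K : realType) (d : nat) (H : nat -> nat).
Hypothesis H_ratio : forall n, (n * H n.+1 <= (n + d) * H n)%N.

Let nz n : (n.+1%:R : K) != 0. Proof. by rewrite pnatr_eq0. Qed.

Lemma cvg_shift_ratio c : (fun n => (n + c)%:R / n.+1%:R : K) @ \oo --> (1 : K).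
Proof.
have -> : (fun n => (n + c)%:R / n.+1%:R : K) = (fun n => 1 + (c%:R - 1) * harmonic n).
  apply/funext => n; rewrite /harmonic /=; apply: (mulIf (nz n)).
  rewrite mulfVK // mulrDl mul1r mulfVK //.
  by rewrite natrD -addn1 natrD addrACA subrr addr0 addrC.
suff : (fun n => 1 + (c%:R - 1) * harmonic n) @ \oo --> (1 + (c%:R - 1) * 0 : K).
  by rewrite mulr0 addr0.
by apply: cvgD; [apply: cvg_cst | apply: cvgM; [apply: cvg_cst | apply: cvg_harmonic]].
Qed.

Lemma cvg1_prod m (f : nat -> nat -> K) : (forall i, f i @ \oo --> (1 : K)) ->
  (fun n => \prod_(i < m) f i n) @ \oo --> (1 : K).
Proof.
move=> hf; elim: m => [|m IH].
  by under eq_fun do rewrite big_ord0; apply: cvg_cst.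
under eq_fun do rewrite big_ord_recr /=.
suff : (fun n => \prod_(i < m) f i n * f m n) @ \oo --> (1 * 1 : K) by rewrite mulr1.
exact: cvgM.
Qed.

Let w n : K := (d`!)%:R * 'C(n + d, d)%:R / (n.+1 ^ d)%:R.

Lemma cvg_binomial : w @ \oo --> (1 : K).
Proof.
have -> : w = (fun n => \prod_(i < d) ((n + (d - i))%:R / n.+1%:R)).
  apply/funext => n; rewrite /w -natrM mulnC bin_ffact ffact_prod natr_prod.
  rewrite big_split /= prodfV prodr_const card_ord natrX; congr (_ * _).
  by apply: eq_bigr => i _; rewrite addnBA // ltnW.
by apply: (@cvg1_prod d (fun i n => (n + (d - i))%:R / n.+1%:R)) => i; apply: cvg_shift_ratio.
Qed.

(** The sequence whose limit is the multiplicity, when [H] is the Hilbert-Samuel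
    function. *)
Definition hseq n : K := (d`!)%:R * (H n)%:R / (n ^ d)%:R.

Let u n : K := (H n.+1)%:R / 'C(n + d, d)%:R.

Let bin_gt0 n : 0 < ('C(n + d, d)%:R : K).
Proof. by rewrite ltr0n bin_gt0 leq_addl. Qed.

Lemma u_cvg : cvgn u.
Proof.
apply: nonincreasing_is_cvgn; last first.
  by exists 0 => _ [n _ <-]; apply: divr_ge0; apply: ler0n.
apply/nonincreasing_seqP => n.
rewrite /u ler_pdivrMr // mulrAC ler_pdivlMr // -!natrM ler_nat.
rewrite -(leq_pmul2l (ltn0Sn n)) mulnA.
have E : ((n + d).+1 * 'C(n + d, d) = n.+1 * 'C(n.+1 + d, d))%N.
  by have := mul_bin_down (n.+1 + d) d; rewrite addSn /= -addSn addnK.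
rewrite [leqRHS]mulnCA -E [leqRHS]mulnA leq_mul2r; apply/orP; right.
by rewrite [leqRHS]mulnC -addSn.
Qed.

Lemma hseqS n : hseq n.+1 = w n * u n.
Proof.
rewrite /hseq /w /u; have /lt0r_neq0 := bin_gt0 n.
have : (n.+1 ^ d)%:R != 0 :> K by rewrite pnatr_eq0 expn_eq0.
move: (n.+1 ^ d)%:R ('C(n + d, d)%:R) (d`!)%:R (H n.+1)%:R => N B D h N0 B0.
by field; rewrite N0 B0.
Qed.

(** The normalized sequence converges, because [H n.+1 / 'C(n + d, d)] does not
    increase. *)
Lemma hseq_cvg : hseq @ \oo --> limn u.
Proof.
rewrite -cvg_shiftS.
have -> : [sequence hseq n.+1]_n = (fun n => w n * u n).
  by apply/funext => n; rewrite -hseqS.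
suff : (fun n => w n * u n) @ \oo --> 1 * limn u by rewrite mul1r.
by apply: cvgM; [exact: cvg_binomial | exact: u_cvg].
Qed.

(** Along the subsequence [q * (n + 1 + d)] the normalized sequence is bounded
    below by a sequence with limit [k / q ^ d]. *)
Lemma hseq_lower q k : (0 < q)%N ->
  (forall n, ('C(n + d, d) * k <= H (q * (n.+1 + d)))%N) ->
  k%:R / (q ^ d)%:R <= limn u.
Proof.
move=> q0 hk.
pose f n := w n * (\prod_(i < d) ((n + d.+1)%:R / n.+1%:R)^-1) * (k%:R / (q ^ d)%:R).
have f_cvg : f @ \oo --> (k%:R / (q ^ d)%:R : K).
  suff : f @ \oo --> (1 * 1 * (k%:R / (q ^ d)%:R) : K) by rewrite !mul1r.
  apply: cvgM; last exact: cvg_cst.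
  apply: cvgM; first exact: cvg_binomial.
  apply: (@cvg1_prod d (fun i n => ((n + d.+1)%:R / n.+1%:R)^-1)) => i.
  suff : (fun n => ((n + d.+1)%:R / n.+1%:R)^-1 : K) @ \oo --> (1^-1 : K) by rewrite invr1.
  apply: cvgV; first exact: oner_neq0.
  exact: cvg_shift_ratio.
have g_cvg : (fun n => hseq (q * (n.+1 + d))%N) @ \oo --> limn u.
  have -> : (fun n => hseq (q * (n.+1 + d))%N) = hseq \o (muln q) \o (addn^~ d.+1).
    by apply/funext => n /=; rewrite addSnnS.
  apply: cvg_comp; first exact: cvg_addnr.
  by apply: cvg_comp; [exact: cvg_mulnl q0 | exact: hseq_cvg].
apply: (ler_cvg_to f_cvg g_cvg); apply: nearW => n.
have nd0 : (0 : K) < (n.+1 + d)%:R by rewrite ltr0n.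
have q0' : (0 : K) < q%:R by rewrite ltr0n.
rewrite /f /hseq /w prodr_const card_ord invf_div addnS -addSn expnMn !natrM !natrX.
rewrite expr_div_n [X in _ <= X]mulrAC.
have -> : (d`!)%:R * 'C(n + d, d)%:R / n.+1%:R ^+ d *
    (n.+1%:R ^+ d / (n.+1 + d)%:R ^+ d) * (k%:R / q%:R ^+ d) =
    (d`!)%:R / (q%:R ^+ d * (n.+1 + d)%:R ^+ d) * ('C(n + d, d) * k)%:R :> K.
  have : n.+1%:R ^+ d != 0 :> K by rewrite expf_neq0.
  have : (n.+1 + d)%:R ^+ d != 0 :> K by rewrite expf_neq0 // gt_eqF.
  have : q%:R ^+ d != 0 :> K by rewrite expf_neq0 // gt_eqF.
  rewrite natrM; move: (q%:R ^+ d) ((n.+1 + d)%:R ^+ d) (n.+1%:R ^+ d).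
  by move=> Q N' N Q0 N'0 N0; field; rewrite Q0 N'0 N0.
apply: ler_wpM2l; last by rewrite ler_nat.
by apply: divr_ge0; [apply: ler0n | rewrite mulr_ge0 ?exprn_ge0 // ltW].
Qed.

End Asymptotics.

(** * The two inequalities *)

Section ParameterIdeals.
Variables (R : comNzRingType) (m : idealr R) (p d : nat).
Hypothesis hp : p \in [pchar R].
Hypotheses (noethR : noetherian R) (locR : local_ring m).
Hypotheses (hequi : equidimensional R) (hCM : image_of_cohen_macaulay R).
Hypothesis hd : krull_dim R d.
Implicit Types (x y : seq R).

Local Notation tc := (tight_closure hp).

Lemma param_perm x y : perm_eq x y -> is_param (ideal_of m) d x -> is_param (ideal_of m) d y.
Proof.
move=> xy [sx xm hx]; have E : x =i y := perm_mem xy; split.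
- by rewrite -(perm_size xy).
- by move=> u; rewrite -E; apply: xm.
- by move=> u /hx[k]; rewrite (gen_eqmem E); exists k.
Qed.

(** The radical is unchanged, because a high power of [(x)] lies in the ideal of the
    [q]-th powers. *)
Lemma param_powq q x : (0 < q)%N -> is_param (ideal_of m) d x ->
  is_param (ideal_of m) d (powq q x).
Proof.
move=> q0 [sx xm hx]; split; first by rewrite size_map.
  by move=> _ /mapP[u /xm um ->]; case: q q0 => // q _; rewrite exprS; apply: idlMr.
move=> u /hx[k uk]; exists (k * (q * (1 + size x)))%N.
rewrite exprM -pw1; apply: (@pw_frob_sub _ q x 1 _ q0 (leqnn _)).
exact: pw_exp.
Qed.

Lemma param_captures x : is_param (ideal_of m) d x -> captures x.
Proof.
move=> hx y z r hperm.
have [|c cR hc] := parameter_colon noethR locR hequi hCM hd (x := y ++ z :: r).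
  by apply: param_perm hx; rewrite perm_sym.
exists c => // a k u sa; rewrite gen_adds => hu.
have := hc (a ++ k :: nseq (size r) 0%N).
rewrite -/(pows _ _) pows_cat // => h.
have {h} /good_cat[_ [h _]] : good c idl_zero (pows y a ++ pows (z :: r) (k :: nseq (size r) 0%N)).
  apply: h; case: hx => <- _ _; rewrite -(perm_size hperm) !size_cat /= size_nseq.
  by rewrite sa.
exact: h.
Qed.

Variable x : seq R.
Hypothesis hx : is_param (ideal_of m) d x.

Lemma tc_frobenius_length e n : chain n (tc (ideal_gen x)) idl_top ->
  chain ((p ^ e) ^ d * n) (tc (frobenius_pow (ideal_gen x) (p ^ e))) idl_top.
Proof.
move=> hn; rewrite (frobenius_gen hp).
have := @chain_tc_powers _ _ hp x n (p ^ e) [::] x (param_captures hx) (perm_refl x) hn.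
by case: hx => -> _ _.
Qed.

(** Combines [(x)^(q (n+1+d))], contained in [(x^q)^(n+1)], with the binomial lower
    bound for the tight closure of the latter. *)
Lemma hsf_lower e k n : fin (ideal_gen x) idl_top ->
  chain k (tc (frobenius_pow (ideal_gen x) (p ^ e))) idl_top ->
  ('C(n + d, d) * k <= hsf x (p ^ e * (n.+1 + d)))%N.
Proof.
move=> hf hk; have q0 : (0 < p ^ e)%N by rewrite expn_gt0 prime_gt0 ?(pcharf_prime hp).
have hxq := param_powq q0 hx.
apply: ilen_ge; first exact: fin_pw.
rewrite (frobenius_gen hp) in hk.
have := @chain_tc_mixed _ _ hp _ (powq (p ^ e) x) n [::] k (param_captures hxq) (perm_refl _) hk.
have [-> _ _] := hxq; apply: chain_weak => // u ux; apply: tc_sub; apply: isum_subr.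
by apply: pw_frob_sub ux => //; case: hx => -> _ _.
Qed.

Variable K : realType.
Local Open Scope ereal_scope.

Lemma multiplicity_fin : fin (ideal_gen x) idl_top ->
  multiplicity K d (ideal_gen x) =
  (limn (fun n => (hsf x n.+1)%:R / 'C(n + d, d)%:R : K))%:E.
Proof.
move=> hf; have hr n : (n * hsf x n.+1 <= (n + d) * hsf x n)%N.
  by have := hsf_ratio hf n; case: hx => -> _ _.
apply: cvg_lim; first exact: ereal_hausdorff.
have -> : (fun n => (d`!)%:R%:E * quot_length K (ideal_pow (ideal_gen x) n)
    * ((n ^ d)%:R^-1)%:E) = EFin \o hseq K d (hsf x).
  apply/funext => n; rewrite ideal_powE quot_length_fin; last exact: fin_pw.
  by rewrite -!EFinM.
apply: cvg_comp; first exact: (hseq_cvg hr).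
exact: cvg_id.
Qed.

(** Every [R/I^n] with [n > 0] maps onto [R/I], so the sequence is constantly
    infinite from [n = 1] on. *)
Lemma multiplicity_inf : ~ fin (ideal_gen x) idl_top ->
  multiplicity K d (ideal_gen x) = +oo.
Proof.
move=> hf; apply: cvg_lim; first exact: ereal_hausdorff.
apply: cvg_near_cst; exists 1%N => // n /= n1.
rewrite quot_length_inf; last first.
  move=> h; apply: hf; apply: fin_sub h => //.
  by rewrite ideal_powE -pw1; apply: pw_le.
rewrite gt0_muley ?lte_fin ?ltr0n ?fact_gt0 // gt0_mulye //.
by rewrite lte_fin invr_gt0 ltr0n expn_gt0 n1.
Qed.

End ParameterIdeals.

Theorem mainTheorem2 (K : realType) (R : comNzRingType) (m : idealr R)
    (p : nat) (hp : p \in [pchar R])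
    (hnoeth : noetherian R) (hlocal : local_ring m)
    (hequi : equidimensional R) (hCM : image_of_cohen_macaulay R)
    (d : nat) (hd : krull_dim R d)
    (I : ideal R) (hI : parameter_ideal m d I) (e : nat) :
  let q := (p ^ e)%N in
  (multiplicity K d I
     >= quot_length K (tight_closure hp (frobenius_pow I q))
          * (((q ^ d)%:R)^-1)%:E)%E /\
  (quot_length K (tight_closure hp (frobenius_pow I q)) * (((q ^ d)%:R)^-1)%:E
     >= quot_length K (tight_closure hp I))%E.
Proof.
move=> q; have [x [xm [_ xrad] /ideal_eqi ->]] := hI.
have hx : is_param (ideal_of m) d x.
  split; first by rewrite size_tuple.
    by move=> u /xm; rewrite ideal_ofE.
  by move=> u; rewrite ideal_ofE -xrad => /asboolP.
have qd0 : (0 < q ^ d)%N by rewrite !expn_gt0 prime_gt0 ?(pcharf_prime hp).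
have qdK : (0 < ((q ^ d)%:R^-1 : K))%R by rewrite invr_gt0 ltr0n.
set J := tight_closure hp (frobenius_pow _ _).
split.
  have [hf|hf] := pselect (fin (ideal_gen x) idl_top); last first.
    by rewrite multiplicity_inf ?leey.
  have lowJ k n : chain k J idl_top -> ('C(n + d, d) * k <= hsf x (q * (n.+1 + d)))%N.
    exact: (hsf_lower hnoeth hlocal hequi hCM hd hx).
  have finJ : fin J idl_top.
    exists (hsf x (q * (1 + d)))%N => k /(lowJ k 0%N).
    by rewrite add0n binn mul1n.
  rewrite (multiplicity_fin hx) // quot_length_fin // -EFinM lee_fin.
  apply: hseq_lower => [n||n].
  - by have := hsf_ratio hf n; case: hx => -> _ _.
  - by rewrite expn_gt0 prime_gt0 ?(pcharf_prime hp).
  - by apply: lowJ; apply: ilen_chain => //; apply: sub_top.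
have tcJ n : chain n (tight_closure hp (ideal_gen x)) idl_top -> chain (q ^ d * n) J idl_top.
  exact: (tc_frobenius_length (hp := hp) hnoeth hlocal hequi hCM hd hx).
have [[N finJ]|finJ] := pselect (fin J idl_top); last first.
  by rewrite (@quot_length_inf _ J) // gt0_mulye ?leey // lte_fin.
have finI : fin (tight_closure hp (ideal_gen x)) idl_top.
  by exists N => n /tcJ/finJ; apply: leq_trans; rewrite leq_pmull.
rewrite !quot_length_fin //; last by exists N.
rewrite -EFinM lee_fin ler_pdivlMr ?ltr0n // -natrM ler_nat mulnC.
apply: ilen_ge; first by exists N.
by apply: tcJ; apply: ilen_chain => //; apply: sub_top.
Qed.
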